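(* The solvability threshold for the $2$-core 3XOR-SAT problem is $c^*_{\mathrm{SAT,2core}}=1$. That is, the unique number $c^*\in(\frac23,\infty)$ such that, as $m,n\to\infty$ with $\frac mn\to c$, the probability $P_{m,n}$ that a random $m\times n$ $2$-core 3XOR-SAT system is solvable satisfies $$\lim_{m/n\to c}P_{m,n}=\begin{cases}1,&\text{if }\frac23<c<c^*,\\0,&\text{if }c>c^*,\end{cases}$$ is $c^*=1$.
   Context: A 3XOR-SAT system of size $m\times n$ is a linear system $\Gamma z=b\pmod 2$ with $\Gamma$ an $m\times n$ matrix with non-negative integer entries in which every row sums to exactly $3$, and $b\in\{0,1\}^m$. $\Gamma$ is a $2$-core if every column of $\Gamma$ has sum at least $2$. The system is solvable if there is a binary vector $z\in\{0,1\}^n$ with $\Gamma z=b\pmod2$. Random model: a system is generated uniformly at random among $2$-core systems, where a system is specified by an assignment of the $3m$ slots (three ordered slots in each of the $m$ rows) to the $n$ variables such that each variable is assigned at least two slots, together with a vector $b\in\{0,1\}^m$; the entry $\Gamma_{ij}$ is the number of slots of row $i$ assigned to variable $j$. Thus there are $2^m S_2(3m,n)\,n!$ equally likely systems, where $S_2(p,q)$ is the number of partitions of a $p$-element set into $q$ blocks each of size at least $2$. $P_{m,n}$ is the probability that the random system is solvable. The limit $\lim_{m/n\to c}P_{m,n}$ means the limit of $P_{m_k,n_k}$ along arbitrary sequences of integers $m_k,n_k\ge k$ with $\lim_{k\to\infty}m_k/n_k=c$. *)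

(* Defs.v *)
From HB Require Import structures.
From mathcomp Require Import all_boot all_order all_algebra.
From mathcomp Require Import all_classical all_reals all_analysis.

Set Implicit Arguments.
Unset Strict Implicit.
Unset Printing Implicit Defensive.

Import Order.TTheory GRing.Theory Num.Theory.
Import numFieldNormedType.Exports.

Local Open Scope nat_scope.

(* Slot (i, k) is the k-th of the three ordered slots of row i. *)
Definition slot_assignment (m n : nat) : finType :=
  {ffun 'I_m * 'I_3 -> 'I_n}.

(* The matrix Gamma; a variable repeated in a row is counted with
   multiplicity. *)
Definition xor_matrix (m n : nat) (f : slot_assignment m n) : 'M[nat]_(m, n) :=
  \matrix_(i, j) #|[set k : 'I_3 | f (i, k) == j]|.

Definition is_3xor_matrix (m n : nat) (G : 'M[nat]_(m, n)) : bool :=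
  [forall i, \sum_j G i j == 3].

Definition two_core (m n : nat) (G : 'M[nat]_(m, n)) : bool :=
  [forall j, 2 <= \sum_i G i j].

(* Bits are booleans, coerced to the naturals 0 and 1. *)
Definition xor_solvable (m n : nat) (G : 'M[nat]_(m, n))
    (b : {ffun 'I_m -> bool}) : bool :=
  [exists z : {ffun 'I_n -> bool},
    [forall i, \sum_j G i j * z j == b i %[mod 2]]].

Lemma xor_matrix_is_3xor (m n : nat) (f : slot_assignment m n) :
  is_3xor_matrix (xor_matrix f).
Proof.
apply/forallP => i; apply/eqP.
under eq_bigr do rewrite mxE -sum1dep_card.
rewrite -[RHS](card_ord 3) -sum1_card [RHS](partition_big (fun k => f (i, k)) xpredT) //.
Qed.

Definition two_core_systems (m n : nat) :
    {set slot_assignment m n * {ffun 'I_m -> bool}} :=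
  [set s | two_core (xor_matrix s.1)].

Definition solvable_systems (m n : nat) :
    {set slot_assignment m n * {ffun 'I_m -> bool}} :=
  [set s in two_core_systems m n | xor_solvable (xor_matrix s.1) s.2].

Local Open Scope classical_set_scope.
Local Open Scope ring_scope.

(* Equal to 0 when there is no 2-core system of size m x n (for instance when
   3m < 2n); this occurs only finitely often along sequences with
   m / n --> c > 2 / 3. *)
Definition solvable_prob (R : realType) (m n : nat) : R :=
  #|solvable_systems m n|%:R / #|two_core_systems m n|%:R.

(* lim_(m/n -> c) P m n = l *)
Definition ratio_lim (R : realType) (P : nat -> nat -> R) (c l : R) : Prop :=
  forall m n : nat -> nat,
    (forall k, (k <= m k)%N /\ (k <= n k)%N) ->
    (m k)%:R / (n k)%:R @[k --> \oo] --> c ->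
    P (m k) (n k) @[k --> \oo] --> l.

Definition is_sat_threshold (R : realType) (cs : R) : Prop :=
  2 / 3 < cs /\
  forall c : R,
    (2 / 3 < c < cs -> ratio_lim (@solvable_prob R) c 1) /\
    (cs < c -> ratio_lim (@solvable_prob R) c 0).

(* Main.v *)
Require Import Defs.
From mathcomp Require Import all_boot all_order all_algebra.
From mathcomp Require Import all_classical all_reals all_analysis.
From mathcomp Require Import ring lra zify.

Set Implicit Arguments.
Unset Strict Implicit.
Unset Printing Implicit Defensive.

Import Order.TTheory GRing.Theory Num.Theory.
Import numFieldNormedType.Exports.

Local Open Scope ring_scope.

(** For a fixed matrix Gamma at most 2^n of the 2^m right-hand sides are
    solvable, since there are 2^n vectors z.  So P <= 2^(n-m), which tends to 0
    when c > 1.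

    Let 2/3 < c < 1.  If the rows of Gamma are independent mod 2, then every b
    is solvable.  A dependency is a nonempty set S of rows in which each
    variable occurs an even number of times, and the proof is a first moment
    computation: the expected number of such S tends to 0.  Write k = 3m,
    g(x) = e^x - 1 - x (tail_exp), nu = 3m/n - 2 in (0,1), and let l be the
    saddle point of g^n / x^k, so that l g'(l) / g(l) = 2 + nu.

    - Number of 2-cores.  It is k! [x^k] g^n (card_core_fun).  Since g^n has
      log-concave coefficients, at a suitable x its k-th term is the largest one;
      by Chebyshev most of g(x)^n comes from O(sqrt n) terms, and a convexity
      argument returns to the saddle point: [x^k] g^n is at least
      g(l)^n / (38 sqrt n l^k) (coef_core_poly_lower, tail_exp_jensen).  A loss
      of order n would be too much, as dependent pairs of rows contribute a
      term of order 1/n.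
    - Dependent sets.  Permuting the slots shows that the number of 2-cores in
      which a set of slots meets every variable evenly depends only on the size
      of that set.  Average over a random set containing each slot with
      probability p: it meets a variable of degree d evenly with probability
      (1 + (1-2p)^d) / 2, independently for distinct variables, so each variable
      contributes the generating function (g(x) + g((1-2p) x)) / 2.  Hence,
      for every p in (0,1), the expected number of dependent sets of s rows is
      at most
        38 sqrt n ((1 + r) / 2)^n / ('C(m,s)^2 (p^s (1-p)^(m-s))^3),
        r = g((1-2p) l) / g(l)
      (even_core_bound, dependent_row_bound).
    - Choice of p.  For s small compared with m, p = sqrt(s/m) gives
      (K s / m)^(s/2) up to the factor sqrt n; single rows are never dependent,
      so the sum is O(1 / sqrt n).  For s close to m, a constant p close to 1
      gives an exponentially small bound because g(-l) < g(l).  In between,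
      p / (1-p) = (s / (m-s))^(2/3) makes all entropy terms collapse: with
      B = (p^(3/2) + (1-p)^(3/2))^2 the bound is at most
      38 sqrt n (m+1)^2 ((1 + r) / 2)^n / B^m, so it remains to see that
      (1 + r) / 2 < B^(m/n).  Here B = 1 - b with b = (3 w^2 - w^3) / 4,
      w = 2 sqrt(p (1-p)).  A second-order Bonferroni inequality bounds r by a
      polynomial in t = |1 - 2p| and nu (tail_exp_ratio_le), the weighted
      AM-GM inequality replaces B^(m/n) by a rational function
      (expr_le_weighted), and what is left is a polynomial inequality on the
      quarter circle t^2 + w^2 = 1 (gap_product).

    Uniqueness holds because two thresholds would give both limits 0 and 1 to
    every ratio between them, and every ratio is attained by some sequence. *)

(** * Exponential generating functions of functions with weighted fibers *)

Lemma deriv_prod (R : comNzRingType) (I : eqType) (r : seq I) (P : I -> {poly R}) :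
  uniq r ->
  (\prod_(v <- r) P v)^`() =
  \sum_(u <- r) \prod_(v <- r) (if v == u then (P v)^`() else P v).
Proof.
elim: r => [_|w r IH /= /andP[wr ur]]; first by rewrite !big_nil derivC.
rewrite !big_cons derivM IH // eqxx; congr (_ + _).
  congr (_ * _); apply: eq_big_seq => v vr; case: eqP => // vw.
  by rewrite -vw vr in wr.
rewrite big_distrr; apply: eq_big_seq => u ur' /=; rewrite big_cons.
by case: eqP => // wu; rewrite wu ur' in wr.
Qed.

(** Removing one slot, which takes a value u, shifts the weight W u by one; on
    the side of the generating functions this is differentiation of the factor
    P u.  Summing over u gives the derivative of the product, so the identity
    follows by induction on the number of slots. *)
Lemma egf_count_ord (R : comNzRingType) (I : finType) (k : nat)
    (W : I -> nat -> R) (P : I -> {poly R}) :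
  (forall v d, (d <= k)%N -> (P v)`_d *+ d`! = W v d) ->
  \sum_(f : {ffun 'I_k -> I}) \prod_v W v #|[set t | f t == v]| =
  (\prod_v P v)`_k *+ k`!.
Proof.
elim: k W P => [|k IH] W P PW.
  rewrite (bigD1 (ffun0 (card_ord 0))) //=.
  rewrite [X in _ + X]big1 ?addr0 => [|f /eqP[]]; last by apply/ffunP => -[].
  rewrite -horner_coef0 horner_prod mulr1n; apply: eq_bigr => v _.
  by rewrite horner_coef0 -PW // (_ : #|_| = 0%N) ?mulr1n //; apply: eq_card0 => -[].
pose h (uf : I * {ffun 'I_k -> I}) : {ffun 'I_k.+1 -> I} :=
  [ffun t => oapp uf.2 uf.1 (unlift ord0 t)].
rewrite (reindex h) /=; last first.
  exists (fun f => (f ord0, [ffun t => f (lift ord0 t)])) => [[u f] _|f _].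
    by rewrite /h ffunE unlift_none; congr pair; apply/ffunP => t; rewrite !ffunE liftK.
  by apply/ffunP => t; rewrite ffunE; case: unliftP => [j|] -> //=; rewrite ffunE.
have hcard u f v : #|[set t | h (u, f) t == v]| = ((u == v) + #|[set t | f t == v]|)%N.
  rewrite -!sum1dep_card big_mkcond big_ord_recl /h ffunE unlift_none /=.
  congr addn.
  by rewrite [RHS]big_mkcond; apply: eq_bigr => t _; rewrite ffunE liftK.
rewrite -(pair_bigA _ (fun u f => \prod_v W v #|[set t | h (u, f) t == v]|)) /=.
rewrite factS mulrnA -coef_deriv deriv_prod ?index_enum_uniq //.
rewrite coef_sum -sumrMnl; apply: eq_bigr => u _.
rewrite -(IH (fun v d => W v ((u == v) + d)%N)) => [|v d dk].
  by apply: eq_bigr => f _; apply: eq_bigr => v _; rewrite hcard.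
rewrite eq_sym; case: eqP => _.
  by rewrite coef_deriv -mulrnA -factS PW.
by rewrite PW // ltnW.
Qed.

Lemma egf_count (R : comNzRingType) (T I : finType)
    (W : I -> nat -> R) (P : I -> {poly R}) :
  (forall v d, (d <= #|T|)%N -> (P v)`_d *+ d`! = W v d) ->
  \sum_(f : {ffun T -> I}) \prod_v W v #|[set t | f t == v]| =
  (\prod_v P v)`_(#|T|) *+ (#|T|)`!.
Proof.
move=> PW; rewrite -(egf_count_ord PW).
rewrite (reindex (fun f : {ffun 'I_#|T| -> I} => [ffun t => f (enum_rank t)])) /=.
  apply: eq_bigr => f _; apply: eq_bigr => v _; congr (W v _).
  rewrite -(card_imset _ (@enum_rank_inj T)); congr #|pred_of_set _|.
  apply/setP => i; rewrite inE; apply/imsetP/idP => [[t]|fi].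
    by rewrite inE ffunE => ? ->.
  by exists (enum_val i); rewrite ?inE ?ffunE enum_valK.
exists (fun f : {ffun T -> I} => [ffun i => f (enum_val i)]) => f _;
  by apply/ffunP => t; rewrite !ffunE ?enum_rankK ?enum_valK.
Qed.

(** * Sets of slots meeting every fiber evenly *)

Lemma prod_if1 (R : comNzRingType) (T : finType) (A : {pred T}) (x : R) :
  \prod_t (if t \in A then x else 1) = x ^+ #|A|.
Proof. by rewrite -big_mkcond prodr_const. Qed.

Definition fiber (T I : finType) (f : {ffun T -> I}) (v : I) : {set T} :=
  [set t | f t == v].

Definition even_on (T I : finType) (f : {ffun T -> I}) (s : {set T}) : bool :=
  [forall v, ~~ odd #|fiber f v :&: s|].

(** Each factor (1 + (-1)^a) / 2 of the indicator is a sum of two terms, so the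
    product over the values v expands over the sets J of values where the
    second term is chosen. *)
Lemma even_on_sum (R : numFieldType) (T I : finType) (f : {ffun T -> I}) (s : {set T}) :
  (even_on f s)%:R =
  2^-1 ^+ #|I| * \sum_(J : {set I}) \prod_t
    (if (f t \in J) && (t \in s) then -1 else 1) :> R.
Proof.
transitivity (\prod_v ((1 + (-1) ^+ #|fiber f v :&: s|) / 2) : R).
  case: (boolP (even_on f s)) => [/forallP ev|/forallPn[v]].
    rewrite big1 // => v _; rewrite -signr_odd (negPf (ev v)) expr0.
    by rewrite divff // pnatr_eq0.
  rewrite negbK => ov; rewrite (bigD1 v) //= -signr_odd ov expr1.
  by rewrite subrr mul0r mul0r.
rewrite big_split /= prodr_const cardT -cardE mulrC; congr (_ * _).
under eq_bigr do rewrite addrC.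
rewrite bigA_distr; apply: eq_bigr => J _.
under eq_bigr => v _ do rewrite -prod_if1.
rewrite [RHS](partition_big f xpredT) //=; apply: eq_bigr => v _.
rewrite [RHS]big_mkcond /=; case: ifPn => vJ.
  apply: eq_bigr => t _; rewrite !inE; case: eqP => [->|//]; by rewrite vJ.
by rewrite big1 // => t _; case: eqP => [->|//]; rewrite (negPf vJ).
Qed.

(** A random set that contains each slot with probability p meets a fiber of
    size d evenly with probability (1 + (1-2p)^d) / 2, and the fibers are
    disjoint. *)
Lemma even_on_average (R : numFieldType) (T I : finType) (f : {ffun T -> I}) (p : R) :
  \sum_(s : {set T}) (even_on f s)%:R * (p ^+ #|s| * (1 - p) ^+ #|~: s|) =
  \prod_v ((1 + (1 - p *+ 2) ^+ #|fiber f v|) / 2).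
Proof.
under [LHS]eq_bigr => s _.
  rewrite even_on_sum -[p ^+ _]prod_if1 -[(1 - p) ^+ _]prod_if1 -big_split -mulrA big_distrl /=.
  under eq_bigr do rewrite -big_split /=.
  over.
rewrite -big_distrr exchange_big /=.
rewrite big_split /= prodr_const cardT -cardE mulrC; congr (_ * _).
under [RHS]eq_bigr do rewrite addrC.
rewrite bigA_distr; apply: eq_bigr => J _.
under [LHS]eq_bigr => s _.
  under eq_bigr => t _.
    rewrite (_ : _ * _ = if t \in s then (if f t \in J then - p else p) else 1 - p); last first.
      by rewrite inE; case: (t \in s); case: (f t \in J); rewrite /= ?mul1r ?mulr1 ?mulN1r.
    over.
  over.
rewrite -bigA_distr (partition_big f xpredT) //=; apply: eq_bigr => v _.
case: ifPn => vJ.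
  rewrite -prodr_const big_mkcond [RHS]big_mkcond; apply: eq_bigr => t _.
  by rewrite inE; case: eqP => // ->; rewrite vJ mulr2n; ring.
rewrite big1 // => t /eqP ->; rewrite (negPf vJ); ring.
Qed.

Lemma exists_set_bijection (T : finType) (s s' : {set T}) : #|s| = #|s'| ->
  exists2 h : T -> T, injective h & forall t, (h t \in s') = (t \in s).
Proof.
move=> ss'.
have sC : #|~: s| = #|~: s'| by rewrite [LHS]cardsCs [RHS]cardsCs !finset.setCK ss'.
pose l (r : {set T}) := enum r ++ enum (~: r).
have ul r : uniq (l r).
  rewrite cat_uniq !enum_uniq andbT /=; apply/hasPn => t.
  by rewrite !mem_enum inE.
have ml r t : t \in l r by rewrite mem_cat !mem_enum inE orbN.
have sl : size (l s) = size (l s') by rewrite !size_cat -!cardE ss' sC.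
have il t : (index t (l s) < size (l s'))%N by rewrite -sl index_mem.
exists (fun t => nth t (l s') (index t (l s))) => [t u|t].
  rewrite (set_nth_default u) // => /eqP; rewrite nth_uniq // => /eqP.
  by move/(congr1 (nth t (l s))); rewrite !nth_index.
have := il t; rewrite /l nth_cat index_cat mem_enum -!cardE -ss'.
case: ifPn => ts; rewrite size_cat -!cardE.
  have ts1 : (index t (enum s) < #|s|)%N by rewrite cardE index_mem mem_enum.
  rewrite ts1 => _; rewrite -(mem_enum s') mem_nth // -cardE -ss' //.
rewrite ss' ltn_add2l => ts1; rewrite ltnNge leq_addr /= addKn; apply/negbTE.
by rewrite -finset.in_setC -mem_enum mem_nth // -cardE.
Qed.

Definition core_fun (T I : finType) : {set {ffun T -> I}} :=
  [set f : {ffun T -> I} | [forall v, (1 < #|fiber f v|)%N]].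

(** Slots are exchangeable: a permutation of the slots carrying s to s' acts on
    the functions and preserves all fiber sizes. *)
Lemma card_even_on_eq (T I : finType) (s s' : {set T}) : #|s| = #|s'| ->
  #|[set f in core_fun T I | even_on f s]| = #|[set f in core_fun T I | even_on f s']|.
Proof.
have sub (r r' : {set T}) : #|r| = #|r'| ->
    (#|[set f in core_fun T I | even_on f r']| <= #|[set f in core_fun T I | even_on f r]|)%N.
  move=> /exists_set_bijection[h hI hr].
  pose H (f : {ffun T -> I}) : {ffun T -> I} := [ffun t => f (h t)].
  have HI : injective H.
    move=> f g /ffunP fg; apply/ffunP => t.
    by have := fg (invF hI t); rewrite !ffunE f_invF.
  have hb (A : {set T}) : #|h @^-1: A| = #|A|.
    by rewrite card_preimset.
  rewrite -(card_imset _ HI); apply/subset_leq_card/fintype.subsetP => _ /imsetP[f + ->].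
  rewrite !inE => /andP[/forallP cf /forallP ef]; apply/andP; split.
    apply/forallP => v; rewrite (leq_trans (cf v)) // -hb.
    by apply/subset_leq_card/fintype.subsetP => t; rewrite !inE ffunE.
  apply/forallP => v; have := ef v; rewrite -hb; congr (~~ odd #|pred_of_set _|).
  by apply/setP => t; rewrite !inE ffunE hr.
by move=> ss'; apply/eqP; rewrite eqn_leq !sub.
Qed.

(** Keep, in the average over all sets of slots, only the sets of the same size
    as s; they all contribute equally. *)
Lemma card_even_core_le (R : realFieldType) (T I : finType) (s : {set T}) (p : R) :
  0 <= p <= 1 ->
  'C(#|T|, #|s|)%:R * (p ^+ #|s| * (1 - p) ^+ (#|T| - #|s|)) *
    #|[set f in core_fun T I | even_on f s]|%:R <=
  \sum_(f in core_fun T I) \prod_v ((1 + (1 - p *+ 2) ^+ #|fiber f v|) / 2).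
Proof.
move=> /andP[p0 p1].
under [X in _ <= X]eq_bigr do rewrite -even_on_average.
rewrite exchange_big /=.
under [X in _ <= X]eq_bigr do rewrite -big_distrl /=.
pose Z (r : {set T}) : R := #|[set f in core_fun T I | even_on f r]|%:R.
have ZE r : \sum_(f in core_fun T I) (even_on f r)%:R = Z r.
  rewrite /Z -sum1_card natr_sum [RHS]big_mkcond [LHS]big_mkcond.
  apply: eq_bigr => f _; rewrite !inE.
  by case: [forall _, _] => //=; case: even_on.
under [X in _ <= X]eq_bigr do rewrite ZE.
rewrite (bigID (fun r : {set T} => #|r| == #|s|)) /=.
apply: ler_wpDr.
  by apply: sumr_ge0 => r _; rewrite !mulr_ge0 ?exprn_ge0 ?subr_ge0 ?ler0n.
rewrite (eq_bigr (fun=> Z s * (p ^+ #|s| * (1 - p) ^+ (#|T| - #|s|)))) => [|r /eqP rs].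
  set x := p ^+ _ * _; rewrite sumr_const -[leRHS]mulr_natl.
  set N := (X in _ <= X%:R * _); rewrite (_ : N = 'C(#|T|, #|s|)); last first.
    by rewrite -card_draws cardsE; exact: eq_card.
  by rewrite [leRHS]mulrA [leRHS]mulrAC -/(Z s) lexx.
by rewrite (cardsCs (~: r)) finset.setCK rs /Z (card_even_on_eq _ rs).
Qed.

(** * Log-concave coefficient sequences *)

Definition nneg_poly (R : numDomainType) (p : {poly R}) := forall i, 0 <= p`_i.

Lemma nneg_polyM (R : numDomainType) (p q : {poly R}) :
  nneg_poly p -> nneg_poly q -> nneg_poly (p * q).
Proof. by move=> p0 q0 i; rewrite coefM sumr_ge0 // => j _; rewrite mulr_ge0. Qed.

Lemma nneg_polyX (R : numDomainType) (p : {poly R}) n :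
  nneg_poly p -> nneg_poly (p ^+ n).
Proof.
move=> p0; elim: n => [|n IH]; first by move=> i; rewrite expr0 coef1 ler0n.
by rewrite exprS; exact: nneg_polyM.
Qed.

Lemma coef_le_horner (R : numDomainType) (p : {poly R}) (x : R) k :
  nneg_poly p -> 0 <= x -> p`_k * x ^+ k <= p.[x].
Proof.
move=> p0 x0; rewrite horner_coef.
have [kp|pk] := ltnP k (size p).
  rewrite (bigD1 (Ordinal kp)) //= lerDl sumr_ge0 // => i _.
  by rewrite mulr_ge0 // exprn_ge0.
rewrite nth_default // mul0r sumr_ge0 // => i _.
by rewrite mulr_ge0 // exprn_ge0.
Qed.

(** Log-concavity of the coefficients of p is encoded as total positivity of
    order 2 of this Toeplitz matrix, because that property is stable under
    matrix products and therefore under products of polynomials. *)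
Definition toeplitz (R : nzRingType) (p : {poly R}) (r c : nat) : R :=
  if (c <= r)%N then p`_(r - c) else 0.

Definition tp2 (R : numDomainType) (f : nat -> nat -> R) :=
  forall r1 r2 c1 c2, (r1 <= r2)%N -> (c1 <= c2)%N ->
  f r1 c2 * f r2 c1 <= f r1 c1 * f r2 c2.

Lemma toeplitzM (R : comNzRingType) (p q : {poly R}) (N r c : nat) : (r < N)%N ->
  toeplitz (p * q) r c = \sum_(k < N) toeplitz p r k * toeplitz q k c.
Proof.
move=> rN; rewrite -(big_mkord xpredT (fun k => toeplitz p r k * toeplitz q k c)).
rewrite (@big_cat_nat _ _ _ r.+1) //= [X in _ = _ + X]big_nat_cond.
rewrite [X in _ + X]big1 ?addr0 => [|k /andP[/andP[rk _] _]]; last first.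
  by rewrite {1}/toeplitz leqNgt rk mul0r.
rewrite {1}/toeplitz; case: leqP => [cr|rc]; last first.
  rewrite big_nat_cond big1 // => k /andP[/andP[_ kr] _].
  by rewrite [X in _ * X]/toeplitz leqNgt (leq_trans kr) // mulr0.
rewrite (@big_cat_nat _ _ _ c) //=; last exact: leqW.
rewrite big_nat_cond big1 ?add0r => [|k /andP[/andP[_ kc] _]]; last first.
  by rewrite [X in _ * X]/toeplitz leqNgt kc mulr0.
rewrite -[index_iota c _]/(index_iota (0 + c) _) big_addn coefMr subSn // big_mkord.
apply: eq_bigr => i _; rewrite /toeplitz leq_addl addnK.
have ic : (i + c <= r)%N by have := ltn_ord i; lia.
by rewrite ic addnC subnDA.
Qed.

(** Cauchy-Binet for 2 x 2 minors: after symmetrization in the summation indices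
    the difference of the two sides is a sum of products of two minors of the
    same sign. *)
Lemma tp2_mul (R : realFieldType) (N : nat) (f g : nat -> nat -> R) r1 r2 c1 c2 :
  tp2 f -> tp2 g -> (r1 <= r2)%N -> (c1 <= c2)%N ->
  (\sum_(k < N) f r1 k * g k c2) * (\sum_(k < N) f r2 k * g k c1) <=
  (\sum_(k < N) f r1 k * g k c1) * (\sum_(k < N) f r2 k * g k c2).
Proof.
move=> tf tg r12 c12; rewrite !big_distrlr /= -subr_ge0 -sumrB.
under eq_bigr do rewrite -sumrB.
set F := fun k l : nat => f r1 k * f r2 l.
set H := fun k l : nat => g k c1 * g l c2 - g k c2 * g l c1.
rewrite (eq_bigr (fun k : 'I_N => \sum_(l < N) F k l * H k l)); last first.
  by move=> k _; apply: eq_bigr => l _; rewrite /F /H; ring.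
set S := \sum_(k < N) _.
suff : 0 <= S + S by lra.
rewrite {2}/S exchange_big -big_split /=; apply: sumr_ge0 => k _.
rewrite -big_split; apply: sumr_ge0 => l _ /=.
have -> : F k l * H k l + F l k * H l k = (F k l - F l k) * H k l.
  by rewrite /H; ring.
have [kl|/ltnW lk] := leqP k l.
  rewrite mulr_ge0 // subr_ge0.
    exact: tf.
  exact: tg.
rewrite mulr_le0 // subr_le0.
  exact: tf.
by rewrite [leLHS]mulrC [leRHS]mulrC; apply: tg.
Qed.

Lemma tp2_toeplitzM (R : realFieldType) (p q : {poly R}) :
  tp2 (toeplitz p) -> tp2 (toeplitz q) -> tp2 (toeplitz (p * q)).
Proof.
move=> tp tq r1 r2 c1 c2 r12 c12.
by rewrite !(@toeplitzM _ p q r2.+1) //; exact: tp2_mul.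
Qed.

Lemma tp2_toeplitz1 (R : realFieldType) : tp2 (toeplitz (1 : {poly R})).
Proof.
have tE r c : toeplitz 1 r c = (r == c)%:R :> R.
  by rewrite /toeplitz coef1 subn_eq0 eqn_leq; case: leqP => _; rewrite ?andbT ?andbF.
move=> r1 r2 c1 c2 r12 c12; rewrite !tE -!natrM ler_nat !mulnb.
case: (boolP (_ && _)) => // /andP[/eqP e1 /eqP e2].
by have -> : (r1 == c1) && (r2 == c2) by lia.
Qed.

Lemma tp2_toeplitzX (R : realFieldType) (p : {poly R}) n :
  tp2 (toeplitz p) -> tp2 (toeplitz (p ^+ n)).
Proof.
move=> tp; elim: n => [|n IH]; first exact: tp2_toeplitz1.
by rewrite exprS; exact: tp2_toeplitzM.
Qed.

Lemma tp2_coef (R : realFieldType) (p : {poly R}) i u v : tp2 (toeplitz p) ->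
  p`_i * p`_(i + u + v) <= p`_(i + u) * p`_(i + v).
Proof.
move=> /(_ (i + u)%N (i + u + v)%N 0%N u (leq_addr _ _) (leq0n _)).
rewrite /toeplitz !leq0n !subn0 leq_addl addnK.
have -> : (u <= i + u + v)%N by lia.
by have -> : (i + u + v - u)%N = (i + v)%N by lia.
Qed.

(** By log-concavity the ratios of each coefficient to the preceding one
    decrease, so the tilt that makes the terms k and k+1 equal makes them
    maximal. *)
Lemma mode_tilt (R : realFieldType) (p : {poly R}) k j : tp2 (toeplitz p) ->
  nneg_poly p -> 0 < p`_k -> 0 < p`_k.+1 ->
  p`_j * (p`_k / p`_k.+1) ^+ j <= p`_k.+1 * (p`_k / p`_k.+1) ^+ k.+1.
Proof.
move=> tp p0 pk pk1; set x := p`_k / p`_k.+1.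
have x0 : 0 < x by rewrite divr_gt0.
have [kj|jk] := leqP k.+1 j.
  rewrite -(subnKC kj); elim: (j - k.+1)%N => [|d IH]; first by rewrite addn0.
  apply: le_trans IH; rewrite addnS exprS mulrA ler_wpM2r ?exprn_ge0 ?(ltW x0) //.
  rewrite /x mulrA ler_pdivrMr // mulrC [leRHS]mulrC.
  have := @tp2_coef _ p k 1 d.+1 tp.
  have -> : (k + d.+1 = k.+1 + d)%N by lia.
  have -> : (k + 1 + d.+1)%N = (k.+1 + d).+1 by lia.
  by rewrite addn1.
have {}jk : (j <= k)%N by [].
rewrite -(subKn jk); elim: (k - j)%N => [|d IH].
  rewrite subn0 exprS mulrA ler_wpM2r ?exprn_ge0 ?(ltW x0) //.
  by rewrite /x mulrC divfK ?gt_eqF.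
apply: le_trans IH.
have [kd|dk] := leqP k d.
  by rewrite (_ : k - d.+1 = k - d)%N //; lia.
have e : (k - d = (k - d.+1).+1)%N by lia.
rewrite e exprS mulrA ler_wpM2r ?exprn_ge0 ?(ltW x0) //.
rewrite /x mulrA ler_pdivlMr //.
have := @tp2_coef _ p (k - d.+1) 1 d.+1 tp; rewrite addn1 -e.
have -> : (k - d + d.+1 = k.+1)%N by lia.
by have -> : (k - d.+1 + d.+1 = k)%N by lia.
Qed.

(** * Moments and concentration of coefficients *)

(** The operator x d/dx: its iterates, evaluated at x, are the unnormalized
    moments of the distribution on the exponents j with weights p_j x^j. *)
Definition euler (R : nzRingType) (p : {poly R}) : {poly R} := 'X * p^`().

Lemma coef_euler (R : nzRingType) (p : {poly R}) i : (euler p)`_i = p`_i *+ i.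
Proof. by rewrite /euler coefXM; case: i => [|i] /=; rewrite ?mulr0n // coef_deriv. Qed.

Lemma eulerM (R : comNzRingType) (p q : {poly R}) :
  euler (p * q) = euler p * q + p * euler q.
Proof. by rewrite /euler derivM; ring. Qed.

Lemma eulerD (R : comNzRingType) (p q : {poly R}) :
  euler (p + q) = euler p + euler q.
Proof. by rewrite /euler derivD mulrDr. Qed.

(** The distribution attached to p^n is that of a sum of n independent copies of
    the one attached to p: the mean mu and the variance v add up. *)
Lemma euler_exp (R : comNzRingType) (p : {poly R}) (x mu v : R) n :
  (euler p).[x] = mu * p.[x] -> (euler (euler p)).[x] = (v + mu ^+ 2) * p.[x] ->
  (euler (p ^+ n)).[x] = n%:R * mu * p.[x] ^+ n /\
  (euler (euler (p ^+ n))).[x] = (n%:R * v + (n%:R * mu) ^+ 2) * p.[x] ^+ n.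
Proof.
move=> h1 h2; elim: n => [|n [IH1 IH2]].
  by rewrite expr0 /euler derivC mulr0 derivC mulr0 horner0 !mul0r expr0n /= addr0 !mul0r.
rewrite [p ^+ n.+1]exprS (eulerM p) eulerD (eulerM (euler p)) (eulerM p (euler _)).
move: h1 h2 IH1 IH2; move: (euler (euler (p ^+ n))) (euler (euler p)) => a b.
move: (euler (p ^+ n)) (euler p) => c d h1 h2 IH1 IH2.
rewrite !hornerD !hornerM IH1 IH2 h1 h2 horner_exp [p.[x] ^+ n.+1]exprS.
by rewrite -[n.+1]addn1 natrD; split; ring.
Qed.

Lemma chebyshev_poly (R : realFieldType) (p : {poly R}) (x mu v : R) n :
  (euler p).[x] = mu * p.[x] -> (euler (euler p)).[x] = (v + mu ^+ 2) * p.[x] ->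
  \sum_(j < size (p ^+ n)) (p ^+ n)`_j * x ^+ j * (j%:R - n%:R * mu) ^+ 2 =
  n%:R * v * p.[x] ^+ n.
Proof.
move=> h1 h2; have [e1 e2] := euler_exp n h1 h2.
set P := p ^+ n in e1 e2 *; set c := n%:R * mu in e1 e2 *.
have sz q (P' : {poly R}) : (forall i, P'`_i = q i * P`_i) ->
    P'.[x] = \sum_(j < size P) q j * P`_j * x ^+ j.
  move=> h; rewrite (@horner_coef_wide _ (size P)); first by apply: eq_bigr => i _; rewrite h.
  by apply/leq_sizeP => j jP; rewrite h nth_default // mulr0.
have E1 : (euler P).[x] = \sum_(j < size P) j%:R * P`_j * x ^+ j.
  by apply: (sz (fun i => i%:R)) => i; rewrite coef_euler mulr_natl.
have E2 : (euler (euler P)).[x] = \sum_(j < size P) (j%:R * j%:R) * P`_j * x ^+ j.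
  by apply: (sz (fun i => i%:R * i%:R)) => i; rewrite !coef_euler -mulrA !mulr_natl.
have -> : \sum_(j < size P) P`_j * x ^+ j * (j%:R - c) ^+ 2 =
    (euler (euler P)).[x] - 2 * c * (euler P).[x] + c ^+ 2 * P.[x].
  rewrite E1 E2 horner_coef !big_distrr -sumrB -big_split /=.
  by apply: eq_bigr => j _; ring.
by rewrite e1 e2 horner_exp; ring.
Qed.

(** Chebyshev: at least half of the mass sits on the at most 2D+1 integers at
    distance less than D from c, and each of them has mass at most M. *)
Lemma window_mass (R : realType) (N D : nat) (a : nat -> R) (c V M : R) :
  (0 < D)%N -> 0 <= c -> (forall j, 0 <= a j <= M) ->
  \sum_(j < N) a j * (j%:R - c) ^+ 2 <= V -> 2 * V <= D%:R ^+ 2 * \sum_(j < N) a j ->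
  \sum_(j < N) a j <= 2 * (2 * D + 1)%:R * M.
Proof.
move=> D0 c0 aM hV hD.
have a0 j : 0 <= a j by case/andP: (aM j).
have {}aM j : a j <= M by case/andP: (aM j).
have M0 : 0 <= M by exact: le_trans (aM 0%N).
pose I (j : nat) := `|j%:R - c| < D%:R.
have far : D%:R ^+ 2 * \sum_(j < N | ~~ I j) a j <= V.
  apply: le_trans hV; rewrite big_distrr /= [leRHS](bigID (fun j : 'I_N => I j)) /=.
  apply: ler_wpDl; first by apply: sumr_ge0 => j _; rewrite mulr_ge0 ?sqr_ge0.
  apply: ler_sum => j; rewrite /I -leNgt => Ij; rewrite mulrC ler_wpM2l //.
  by rewrite -[leRHS]real_normK ?num_real // ler_sqr ?nnegrE.
have close : \sum_(j < N | I j) a j <= (2 * D + 1)%:R * M.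
  pose j0 := Num.truncn c.
  have /andP[j0c cj0] : j0%:R <= c < j0.+1%:R by exact: truncn_itv.
  have Iin j : I j -> (j0 - D <= j < j0 - D + (2 * D + 1))%N.
    rewrite /I ltr_norml => /andP[h1 h2].
    have : (j%:R : R) < (j0.+1 + D)%:R by rewrite natrD; lra.
    have : (j0%:R : R) < (j + D)%:R by rewrite natrD; lra.
    by rewrite !ltr_nat; lia.
  rewrite -(big_mkord I a).
  apply: (@le_trans _ _ (\sum_(j0 - D <= j < j0 - D + (2 * D + 1)) M)); last first.
    by rewrite sumr_const_nat addKn mulr_natl.
  rewrite [leLHS]big_mkcond /=.
  have -> : \sum_(0 <= j < N) (if I j then a j else 0) =
     \sum_(j <- [seq j <- index_iota 0 N | I j]) a j by rewrite big_filter -big_mkcond.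
  set s := [seq _ <- _ | _]; set r := index_iota _ _.
  apply: (@le_trans _ _ (\sum_(j <- r | j \in s) a j)).
    rewrite -[leRHS]big_filter (perm_big [seq j <- r | j \in s]) //.
    apply: uniq_perm; rewrite ?filter_uniq ?iota_uniq // => j.
    rewrite /s /r !mem_filter !mem_index_iota.
    by case: (boolP (I j)) => Ij /=; rewrite ?(Iin _ Ij) ?andbT ?andbF.
  rewrite big_mkcond; apply: ler_sum => j _; by case: ifP.
have D2 : 0 < (D%:R : R) ^+ 2 by rewrite exprn_gt0 // ltr0n.
set A := \sum_(j < N | I j) a j in close.
set B := \sum_(j < N | ~~ I j) a j in far.
have SAB : \sum_(j < N) a j = A + B by rewrite (bigID (fun j : 'I_N => I j)).
rewrite SAB in hD *.
have : D%:R ^+ 2 * (2 * B) <= D%:R ^+ 2 * (A + B) by lra.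
rewrite ler_pM2l // => h.
have -> : 2 * (2 * D + 1)%:R * M = 2 * ((2 * D + 1)%:R * M) by rewrite mulrA.
lra.
Qed.

(** * Generating function of the 2-cores *)

(** The generating function of one variable, truncated in degree K: a variable
    of a 2-core occupies d >= 2 slots. *)
Definition core_gf (R : fieldType) (w : nat -> R) (K : nat) : {poly R} :=
  \poly_(d < K.+1) (if (1 < d)%N then w d / d`!%:R else 0).

Lemma weighted_core_count (R : numFieldType) (T I : finType) (w : nat -> R) K : (#|T| <= K)%N ->
  \sum_(f in core_fun T I) \prod_v w #|fiber f v| =
  (core_gf w K ^+ #|I|)`_(#|T|) *+ (#|T|)`!.
Proof.
move=> TK; have -> : core_gf w K ^+ #|I| = \prod_(v : I) core_gf w K by rewrite prodr_const.
rewrite -(@egf_count _ T I (fun _ d => if (1 < d)%N then w d else 0)); last first.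
  move=> v d dT; rewrite coef_poly ltnS (leq_trans dT TK).
  case: ifP => _; last by rewrite mul0rn.
  by rewrite -[LHS]mulr_natr divfK // pnatr_eq0 -lt0n fact_gt0.
rewrite big_mkcond; apply: eq_bigr => f _; rewrite inE.
case: (boolP [forall v, _]) => [/forallP cf|/forallPn[v nv]].
  by apply: eq_bigr => v _; rewrite -/(fiber f v) cf.
by rewrite (bigD1 v) //= -/(fiber f v) (negPf nv) mul0r.
Qed.

Definition core_poly (R : fieldType) : nat -> {poly R} := core_gf (fun=> 1).

Lemma card_core_fun (R : numFieldType) (T I : finType) K : (#|T| <= K)%N ->
  #|core_fun T I|%:R = (core_poly R K ^+ #|I|)`_(#|T|) *+ (#|T|)`!.
Proof.
move=> TK; rewrite -(weighted_core_count _ _ TK) -sum1_card natr_sum.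
by apply: eq_bigr => f _; rewrite prodr_const expr1n.
Qed.

Lemma coef_core_poly (R : numFieldType) K d :
  (core_poly R K)`_d = if (1 < d <= K)%N then d`!%:R^-1 else 0.
Proof. by rewrite coef_poly ltnS mul1r; case: (1 < d)%N; case: (d <= K)%N. Qed.

Lemma core_poly_nneg (R : numFieldType) K : nneg_poly (core_poly R K).
Proof. by move=> d; rewrite coef_core_poly; case: ifP; rewrite ?invr_ge0 ?ler0n. Qed.

Lemma fact_superadd i u v : ((i + u)`! * (i + v)`! <= i`! * (i + u + v)`!)%N.
Proof.
elim: u => [|u IH]; first by rewrite addn0.
rewrite addnS addSn !factS.
have : ((i + u).+1 <= (i + u + v).+1)%N by rewrite ltnS leq_addr.
move=> h; have := leq_mul h IH; lia.
Qed.

Lemma core_poly_tp2 (R : realFieldType) K : tp2 (toeplitz (core_poly R K)).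
Proof.
move=> r1 r2 c1 c2 r12 c12; rewrite /toeplitz.
have nn r c : 0 <= (if (c <= r)%N then (core_poly R K)`_(r - c) else 0).
  by case: ifP => // _; exact: core_poly_nneg.
have [c2r1|r1c2] := leqP c2 r1; last by rewrite mul0r mulr_ge0.
rewrite (leq_trans c12 (leq_trans c2r1 r12)) (leq_trans c12 c2r1) (leq_trans c2r1 r12).
rewrite !coef_core_poly.
have pos d : 0 <= (if (1 < d <= K)%N then d`!%:R^-1 else 0) :> R.
  by case: ifP; rewrite ?invr_ge0 ?ler0n.
case: (boolP (1 < r1 - c2 <= K)%N) => [h1|_]; last by rewrite mul0r mulr_ge0.
case: (boolP (1 < r2 - c1 <= K)%N) => [h2|_]; last by rewrite mulr0 mulr_ge0.
have -> : (1 < r1 - c1 <= K)%N by lia.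
have -> : (1 < r2 - c2 <= K)%N by lia.
rewrite -!invfM lef_pV2 ?posrE ?mulr_gt0 ?ltr0n ?fact_gt0 // -!natrM ler_nat.
have := fact_superadd (r1 - c2) (c2 - c1) (r2 - r1).
have -> : (r1 - c2 + (c2 - c1) + (r2 - r1) = r2 - c1)%N by lia.
have -> : (r1 - c2 + (c2 - c1) = r1 - c1)%N by lia.
by have -> : (r1 - c2 + (r2 - r1) = r2 - c2)%N by lia.
Qed.

Lemma core_poly_gt0 (R : realFieldType) K (x : R) : (1 < K)%N -> 0 < x ->
  0 < (core_poly R K).[x].
Proof.
move=> K1 x0; apply: lt_le_trans (coef_le_horner 2 (@core_poly_nneg R K) (ltW x0)).
by rewrite coef_core_poly K1 mulr_gt0 ?exprn_gt0 // invr_gt0 ltr0n.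
Qed.

(** A bound on the second moment of the truncated Poisson distribution that is
    uniform in x <= 3 and in K: the terms d = 2, 3 have d^2 <= 9, and for
    d >= 4 one has d^2 / d! <= 2 / (d-2)! and x^2 <= 9. *)
Lemma core_poly_moment2 (R : realFieldType) K (x : R) : 0 <= x <= 3 ->
  (euler (euler (core_poly R K))).[x] <= 27 * (core_poly R K).[x].
Proof.
move=> /andP[x0 x3]; set g := core_poly R K.
have g0 : nneg_poly g := @core_poly_nneg R K.
have szg : (size g <= K.+1)%N by exact: size_poly.
rewrite (@horner_coef_wide _ K.+1 (euler _)); last first.
  by apply/leq_sizeP => j jK; rewrite !coef_euler nth_default ?mul0rn // (leq_trans szg).
have step (d : nat) : (euler (euler g))`_d * x ^+ d <=
    9 * (g`_d * x ^+ d) + 18 * (if (1 < d)%N then g`_(d - 2) * x ^+ (d - 2) else 0).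
  have xd e : 0 <= x ^+ e by exact: exprn_ge0.
  rewrite !coef_euler !coef_core_poly.
  case: (ltnP 1 d) => d1 /=; last by rewrite !mul0rn !mul0r !mulr0 addr0.
  case: (leqP d K) => dK /=; last first.
    rewrite !mul0rn !mul0r mulr0 add0r mulr_ge0 // mulr_ge0 //.
    by case: ifP; rewrite ?invr_ge0 ?ler0n.
  have [d3|d4] := leqP d 3.
    have -> : (1 < d - 2 <= K)%N = false by lia.
    rewrite mul0r mulr0 addr0 mulrA ler_wpM2r //.
    rewrite -mulrnA -[leLHS]mulr_natr mulrC ler_wpM2r ?invr_ge0 //.
    by rewrite (ler_nat R _ 9); case: d d3 d1 {dK} => [|[|[|[|]]]].
  have -> : (1 < d - 2 <= K)%N by lia.
  apply: ler_wpDl; first by rewrite !mulr_ge0 ?invr_ge0 ?ler0n.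
  have -> : x ^+ d = x ^+ 2 * x ^+ (d - 2) by rewrite -exprD subnKC // ltnW.
  rewrite !mulrA ler_wpM2r //.
  have x9 : x ^+ 2 <= 9 by rewrite expr2; nra.
  apply: (@le_trans _ _ (d`!%:R^-1 *+ d *+ d * 9)).
    by rewrite -mulrA -expr2 ler_wpM2l // -mulrnA mulrn_wge0 // invr_ge0.
  have -> : (18 : R) = 2 * 9 by ring.
  rewrite mulrAC ler_wpM2r // -mulrnA -[leLHS]mulr_natr mulrC.
  rewrite ler_pdivrMr ?ltr0n ?fact_gt0 // mulrAC ler_pdivlMr ?ltr0n ?fact_gt0 //.
  rewrite -!natrM ler_nat.
  have e : d = (d - 2).+2 by lia.
  rewrite [in X in (_ <= 2 * X)%N]e !factS; nia.
apply: (@le_trans _ _ (\sum_(d < K.+1) (9 * (g`_d * x ^+ d) +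
    18 * (if (1 < d)%N then g`_(d - 2) * x ^+ (d - 2) else 0)))).
  by apply: ler_sum => d _; exact: step.
rewrite big_split -!big_distrr /= -(horner_coef_wide x szg).
have -> : 27 * g.[x] = 9 * g.[x] + 18 * g.[x] by ring.
rewrite lerD2l ler_wpM2l //.
case: K @g g0 szg {step} => [|K] g g0 szg.
  rewrite big_ord_recl big_ord0 addr0 /=.
  by rewrite horner_coef sumr_ge0 // => i _; rewrite mulr_ge0 // exprn_ge0.
rewrite 2!big_ord_recl /= !add0r (horner_coef_wide x szg).
rewrite 2!big_ord_recr /= [leLHS](_ : _ = \sum_(i < K) g`_i * x ^+ i); last first.
  by apply: eq_bigr => i _; rewrite /bump /= !add1n subSS subSS subn0.
by rewrite -addrA lerDl addr_ge0 // mulr_ge0 // exprn_ge0.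
Qed.

(** Both coefficients count the same functions. *)
Lemma coef_core_poly_stable (R : numFieldType) n k K : (k <= K)%N ->
  (core_poly R K ^+ n)`_k = (core_poly R k ^+ n)`_k.
Proof.
move=> kK; have := @card_core_fun R 'I_k 'I_n K; rewrite !card_ord => /(_ kK).
rewrite (@card_core_fun R 'I_k 'I_n k) ?card_ord // => e.
apply: (@mulIf R k`!%:R); first by rewrite pnatr_eq0 -lt0n fact_gt0.
by rewrite !mulr_natr.
Qed.

Lemma coef_core_poly_gt0 (R : realFieldType) n k K :
  (0 < n)%N -> (2 * n <= k <= K)%N -> 0 < (core_poly R K ^+ n)`_k.
Proof.
case: n => // n _; elim: n k => [|n IH] k /andP[nk kK].
  by rewrite expr1 coef_core_poly kK andbT nk invr_gt0 ltr0n fact_gt0.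
rewrite exprS coefM.
have k2 : (2 < k.+1)%N by lia.
rewrite (bigD1 (Ordinal k2)) //= ltr_pwDl //.
  rewrite coef_core_poly (_ : (1 < 2 <= K)%N); last by lia.
  by rewrite mulr_gt0 ?IH ?invr_gt0 ?ltr0n //; lia.
apply: sumr_ge0 => i _.
by rewrite mulr_ge0 //; [apply: core_poly_nneg|apply/nneg_polyX/core_poly_nneg].
Qed.

(** Compare the two sides of the derivative of g^n: coefficientwise g' dominates
    g below the truncation degree. *)
Lemma core_poly_ratio (R : realFieldType) n k K : (0 < n)%N -> (k < K)%N ->
  n%:R * (core_poly R K ^+ n)`_k <= k.+1%:R * (core_poly R K ^+ n)`_k.+1.
Proof.
move=> n0 kK; rewrite !mulr_natl -coef_deriv deriv_exp coefMn lerMn2r gtn_eqF //=.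
case: n n0 => // n _; rewrite exprS !coefM; apply: ler_sum => i _ /=.
rewrite ler_wpM2r //; first exact/nneg_polyX/core_poly_nneg.
rewrite coef_deriv !coef_core_poly.
have iK : (i < K)%N by rewrite (leq_trans (ltn_ord i)).
rewrite iK (ltnW iK) !andbT ltnS.
case: ltnP => i1; last by case: ifP => // _; rewrite mulrn_wge0 // invr_ge0.
rewrite (ltnW i1) factS natrM invfM -[leRHS]mulr_natl mulrA divff ?mul1r //.
Qed.

(** The tilt x making k the mode is at most 3 by core_poly_ratio, so the
    variance is at most 27n and the largest term is a fraction of order
    1 / sqrt n of the total.  The same x serves for all truncations K, which
    lets K tend to infinity afterwards. *)
Lemma coef_core_poly_lower (R : realType) n k :
  (0 < n)%N -> (2 * n < k <= 3 * n)%N ->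
  exists2 x : R, 0 < x <= 3 & forall K, (k <= K)%N ->
    (core_poly R K).[x] ^+ n <= 38 * Num.sqrt n%:R * ((core_poly R k ^+ n)`_k * x ^+ k).
Proof.
move=> n0; case: k => // k; rewrite ltnS => /andP[nk kn].
have gt0 j : (2 * n <= j <= k.+1)%N -> 0 < (core_poly R k.+1 ^+ n)`_j.
  exact: coef_core_poly_gt0.
pose x : R := (core_poly R k.+1 ^+ n)`_k / (core_poly R k.+1 ^+ n)`_k.+1.
have gtk : 0 < (core_poly R k.+1 ^+ n)`_k by apply: gt0; lia.
have gtk1 : 0 < (core_poly R k.+1 ^+ n)`_k.+1 by apply: gt0; lia.
have x0 : 0 < x by rewrite divr_gt0.
have nR : 0 < (n%:R : R) by rewrite ltr0n.
have x3 : x <= 3.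
  rewrite /x ler_pdivrMr //.
  rewrite -(ler_pM2l nR) (le_trans (core_poly_ratio _ n0 (ltnSn k))) //.
  rewrite mulrA ler_wpM2r ?(ltW gtk1) //.
  by rewrite -natrM ler_nat mulnC.
exists x; first by rewrite x0.
move=> K kK; set g := core_poly R K; set P := g ^+ n.
have Pst j : (j <= k.+1)%N -> P`_j = (core_poly R k.+1 ^+ n)`_j.
  move=> jk; rewrite /P /g (coef_core_poly_stable _ _ (leq_trans jk kK)).
  by rewrite (coef_core_poly_stable _ _ jk).
have P0 : nneg_poly P := nneg_polyX n (@core_poly_nneg R K).
have xE : x = P`_k / P`_k.+1 by rewrite !Pst.
rewrite -Pst //.
set M := P`_k.+1 * _.
have PM j : 0 <= P`_j * x ^+ j <= M.
  rewrite mulr_ge0 ?exprn_ge0 ?(ltW x0) //= /M xE; apply: mode_tilt => //.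
  - exact/tp2_toeplitzX/core_poly_tp2.
  - by rewrite Pst.
  - by rewrite Pst.
have K1 : (1 < K)%N by lia.
have g0 : 0 < g.[x] by exact: core_poly_gt0.
have Gn0 : 0 < g.[x] ^+ n by rewrite exprn_gt0.
pose mu := (euler g).[x] / g.[x].
pose v := (euler (euler g)).[x] / g.[x] - mu ^+ 2.
have h1 : (euler g).[x] = mu * g.[x] by rewrite /mu divfK ?gt_eqF.
have h2 : (euler (euler g)).[x] = (v + mu ^+ 2) * g.[x].
  by rewrite /v subrK divfK ?gt_eqF.
have v27 : v <= 27.
  have : (v + mu ^+ 2) <= 27.
    by rewrite -(ler_pM2r g0) -h2 core_poly_moment2 // (ltW x0).
  by have := sqr_ge0 mu; lra.
have mu0 : 0 <= mu.
  rewrite divr_ge0 ?(ltW g0) // horner_coef sumr_ge0 // => i _.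
  by rewrite mulr_ge0 ?exprn_ge0 ?(ltW x0) // coef_euler mulrn_wge0 // core_poly_nneg.
have cheb := chebyshev_poly n h1 h2.
have SP : \sum_(j < size P) P`_j * x ^+ j = g.[x] ^+ n.
  by rewrite -horner_coef /P horner_exp.
pose s := Num.sqrt (n%:R : R).
have s2 : s ^+ 2 = n%:R by rewrite sqr_sqrtr.
have s1 : 1 <= s by rewrite -sqrtr1 ler_wsqrtr // ler1n.
(* The window: D^2 >= 64 n exceeds twice the variance bound 27 n, and
   D <= 9 sqrt n gives 2 (2D+1) <= 38 sqrt n. *)
pose D := (Num.truncn (8 * s)).+1.
have /andP[Ds sD] : (Num.truncn (8 * s))%:R <= 8 * s < D%:R.
  by apply: truncn_itv; lra.
have D9 : D%:R <= 9 * s by rewrite /D -addn1 natrD; lra.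
have nv : 2 * (n%:R * v) <= D%:R ^+ 2.
  apply: (@le_trans _ _ (64 * s ^+ 2)); first by rewrite s2; nra.
  by rewrite !expr2; nra.
have := @window_mass R (size P) D (fun j => P`_j * x ^+ j) (n%:R * mu)
  (n%:R * v * g.[x] ^+ n) M (ltn0Sn _) (mulr_ge0 (ltW nR) mu0) PM.
rewrite cheb SP lexx => /(_ isT) h.
apply: le_trans (h _) _; first by rewrite mulrA ler_wpM2r // ltW.
have M0 : 0 <= M by case/andP: (PM 0%N) => a b; exact: le_trans a b.
rewrite ler_wpM2r // natrD natrM -/s; lra.
Qed.

(** * Partial sums of the exponential series *)

Definition exp_sum (R : realType) (x : R) (N : nat) : R := \sum_(d < N) x ^+ d / d`!%:R.

Lemma exp_sumS (R : realType) (x : R) N :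
  exp_sum x N.+1 = exp_sum x N + x ^+ N / N`!%:R.
Proof. by rewrite /exp_sum big_ord_recr. Qed.

Lemma cvg_exp_sum (R : realType) (x : R) (j : nat) :
  (exp_sum x (N + j)%N @[N --> \oo] --> expR x)%classic.
Proof.
rewrite (cvg_shiftn j); apply: cvg_trans (is_cvg_series_exp_coeff x).
apply: near_eq_cvg; near=> N; rewrite /series /exp_sum /=.
by rewrite big_mkord.
Unshelve. all: by end_near. Qed.

Lemma exp_sum_le (R : realType) (x : R) N : 0 <= x -> exp_sum x N <= expR x.
Proof.
move=> x0; apply: (cvgr_to_ge (@cvg_exp_sum R x N)); near=> M.
rewrite /exp_sum addnC big_split_ord /= lerDl sumr_ge0 // => i _.
by rewrite divr_ge0 ?exprn_ge0.
Unshelve. all: by end_near. Qed.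

Definition tail_exp (R : realType) (x : R) : R := expR x - 1 - x.

Lemma tail_exp_lower (R : realType) (x : R) : 0 <= x -> x ^+ 2 / 2 <= tail_exp x.
Proof.
move=> x0; have := exp_sum_le 3 x0; rewrite /exp_sum /tail_exp.
rewrite !big_ord_recr big_ord0 /= !factS fact0 !muln1 expr0 expr1; lra.
Qed.

Lemma tail_exp_gt0 (R : realType) (x : R) : 0 < x -> 0 < tail_exp x.
Proof.
move=> x0; apply: lt_le_trans (tail_exp_lower (ltW x0)).
by rewrite divr_gt0 // exprn_gt0.
Qed.

(** The remainder of the exponential series is dominated by a geometric series
    of ratio x / (q+1).  For finite partial sums the inequality is proved with
    the next term added to the left-hand side, which makes it inductive. *)
Lemma exp_remainder_le (R : realType) (x : R) (q : nat) : 0 <= x ->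
  (1 - x / q.+1%:R) * (expR x - exp_sum x q) <= x ^+ q / q`!%:R.
Proof.
move=> x0.
have Q0 : 0 < q.+1%:R :> R by rewrite ltr0n.
have F0 j : 0 < j`!%:R :> R by rewrite ltr0n fact_gt0.
have fin j : (1 - x / q.+1%:R) * (exp_sum x (j + q.+1) - exp_sum x q) +
    x ^+ (j + q.+1) / (q.+1%:R * (j + q)`!%:R) <= x ^+ q / q`!%:R.
  elim: j => [|j IH].
    rewrite !add0n exp_sumS exprS.
    by rewrite le_eqVlt; apply/orP; left; apply/eqP; field; rewrite !gt_eqF.
  apply: le_trans IH; rewrite !addSn !addnS exp_sumS [x ^+ _.+2]exprS; set N := (j + q)%N.
  set X := x ^+ N.+1; set S := exp_sum x N.+1; set T := exp_sum x q.
  have hX : X / N.+1`!%:R <= X / (q.+1%:R * N`!%:R).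
    rewrite ler_wpM2l ?exprn_ge0 // lef_pV2 ?posrE ?mulr_gt0 //.
    by rewrite factS natrM ler_wpM2r ?(ltW (F0 _)) // ler_nat ltnS leq_addl.
  have e : (1 - x / q.+1%:R) * (S + X / N.+1`!%:R - T) + x * X / (q.+1%:R * N.+1`!%:R)
     = (1 - x / q.+1%:R) * (S - T) + X / N.+1`!%:R.
    by field; rewrite !gt_eqF.
  by rewrite e lerD2l.
have lim : ((1 - x / q.+1%:R) * (exp_sum x (N + q.+1)%N - exp_sum x q)
    @[N --> \oo] --> (1 - x / q.+1%:R) * (expR x - exp_sum x q))%classic.
  by apply: cvgMr; apply: cvgB; [exact: cvg_exp_sum|exact: cvg_cst].
apply: (cvgr_to_le lim); near=> N; apply: le_trans (fin N); rewrite lerDl.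
by rewrite divr_ge0 ?exprn_ge0 // mulr_ge0 // ltW.
Unshelve. all: by end_near. Qed.

Lemma horner_core_gf (R : realType) (w : nat -> R) K (x : R) :
  (core_gf w K.+1).[x] = \sum_(d < K) w d.+2 / d.+2`!%:R * x ^+ d.+2.
Proof.
by rewrite horner_poly 2!big_ord_recl /= !mul0r !add0r; apply: eq_bigr.
Qed.

Lemma tail_sum (R : realType) K (x : R) :
  \sum_(d < K) x ^+ d.+2 / d.+2`!%:R = exp_sum x K.+2 - 1 - x.
Proof.
rewrite /exp_sum 2!big_ord_recl /= expr0 expr1 !divr1.
have -> : \sum_(i < K) x ^+ bump 0 (bump 0 i) / (bump 0 (bump 0 i))`!%:R =
  \sum_(d < K) x ^+ d.+2 / d.+2`!%:R by apply: eq_bigr.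
ring.
Qed.

Lemma horner_core_poly (R : realType) K (x : R) :
  (core_poly R K.+1).[x] = exp_sum x K.+2 - 1 - x.
Proof.
rewrite horner_core_gf -tail_sum; apply: eq_bigr => d _.
by rewrite mul1r mulrC.
Qed.

Lemma horner_euler_core_poly (R : realType) K (x : R) :
  (euler (core_poly R K.+1)).[x] = x * (exp_sum x K.+1 - 1).
Proof.
rewrite (@horner_coef_wide _ K.+2); last first.
  apply/leq_sizeP => j jK; rewrite coef_euler coef_core_poly.
  by rewrite (_ : (1 < j <= K.+1)%N = false) ?mul0rn //; lia.
rewrite 2!big_ord_recl /= !coef_euler !coef_core_poly /= mul0rn !mul0r !add0r.
rewrite /exp_sum big_ord_recl expr0 divr1 addrAC subrr add0r big_distrr /=.
apply: eq_bigr => i _; rewrite coef_euler coef_core_poly /bump /= !add1n.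
rewrite ltnS ltn_ord.
rewrite -[_^-1 *+ _]mulr_natr [i.+2`!]factS natrM invfM.
have F0 : i.+1`!%:R != 0 :> R by rewrite pnatr_eq0 -lt0n fact_gt0.
have Q0 : i.+2%:R != 0 :> R by rewrite pnatr_eq0.
move: F0 Q0; move: (i.+1`!%:R) (i.+2%:R) => F Q F0 Q0.
by rewrite [x ^+ i.+2]exprS; field; rewrite ?F0 ?Q0.
Qed.

Lemma horner_euler2_core_poly (R : realType) K (x : R) :
  (euler (euler (core_poly R K.+1))).[x] =
  x ^+ 2 * exp_sum x K + x * (exp_sum x K.+1 - 1).
Proof.
rewrite (@horner_coef_wide _ K.+2); last first.
  apply/leq_sizeP => j jK; rewrite !coef_euler coef_core_poly.
  by rewrite (_ : (1 < j <= K.+1)%N = false) ?mul0rn //; lia.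
rewrite 2!big_ord_recl /= !coef_euler !coef_core_poly /= !mul0rn !mul0r !add0r.
rewrite {2}/exp_sum big_ord_recl expr0 divr1 addrAC subrr add0r !big_distrr /=.
rewrite -big_split; apply: eq_bigr => i _ /=.
rewrite !coef_euler coef_core_poly /bump /= !add1n.
rewrite ltnS ltn_ord.
rewrite -[_ *+ _ *+ _]mulrnA -[_^-1 *+ _]mulr_natr natrM.
have -> : i.+2`!%:R = i.+2%:R * i.+1%:R * i`!%:R :> R by rewrite !factS !natrM mulrA.
have -> : i.+1`!%:R = i.+1%:R * i`!%:R :> R by rewrite !factS !natrM.
have -> : i.+2%:R = i.+1%:R + 1 :> R by rewrite -addn1 natrD.
have F0 : i`!%:R != 0 :> R by rewrite pnatr_eq0 -lt0n fact_gt0.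
have Q0 : i.+1%:R != 0 :> R by rewrite pnatr_eq0.
have S0 : i.+1%:R + 1 != 0 :> R by rewrite natr1 pnatr_eq0.
move: F0 Q0 S0; move: (i`!%:R) (i.+1%:R) => F Q F0 Q0 S0.
by rewrite !(exprS x); field; rewrite ?F0 ?Q0 ?S0.
Qed.

Lemma cvg_core_poly (R : realType) (x : R) :
  ((core_poly R K.+1).[x] @[K --> \oo] --> tail_exp x)%classic.
Proof.
under eq_cvg do rewrite horner_core_poly -addn2.
by apply: cvgB; [apply: cvgB; [exact: cvg_exp_sum|]|]; exact: cvg_cst.
Qed.

Lemma cvg_euler_core_poly (R : realType) (x : R) :
  ((euler (core_poly R K.+1)).[x] @[K --> \oo] --> x * (expR x - 1))%classic.
Proof.
under eq_cvg do rewrite horner_euler_core_poly -addn1.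
by apply: cvgMr; apply: cvgB; [exact: cvg_exp_sum|exact: cvg_cst].
Qed.

Lemma cvg_euler2_core_poly (R : realType) (x : R) :
  ((euler (euler (core_poly R K.+1))).[x] @[K --> \oo] -->
   x ^+ 2 * expR x + x * (expR x - 1))%classic.
Proof.
have e K : (euler (euler (core_poly R K.+1))).[x] =
    x ^+ 2 * exp_sum x (K + 0) + x * (exp_sum x (K + 1) - 1).
  by rewrite horner_euler2_core_poly addn0 addn1.
under eq_cvg do rewrite e.
apply: cvgD; apply: cvgMr; first exact: cvg_exp_sum.
by apply: cvgB; [exact: cvg_exp_sum|exact: cvg_cst].
Qed.

Lemma avg_sign_ge0 (R : realFieldType) (t : R) d : -1 <= t <= 1 -> 0 <= (1 + t ^+ d) / 2.
Proof.
move=> t1; rewrite divr_ge0 // -lerBlDl add0r.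
have : `|t ^+ d| <= 1 by rewrite normrX exprn_ile1 // ler_norml.
by rewrite ler_norml => /andP[].
Qed.

(** The weight is nonnegative even for t < 0, so the truncations increase to
    their limit. *)
Lemma core_gf_sign_le (R : realType) (t x : R) K : -1 <= t <= 1 -> 0 <= x ->
  (core_gf (fun d => (1 + t ^+ d) / 2) K).[x] <= (tail_exp x + tail_exp (t * x)) / 2.
Proof.
move=> t1 x0; set w := fun d => _.
have w0 d : 0 <= w d := avg_sign_ge0 d t1.
have cv : ((core_gf w K'.+1).[x] @[K' --> \oo] --> (tail_exp x + tail_exp (t * x)) / 2)%classic.
  have e K' : (core_gf w K'.+1).[x] =
      ((core_poly R K'.+1).[x] + (core_poly R K'.+1).[t * x]) / 2.
    rewrite !horner_core_poly -!tail_sum horner_core_gf -big_split big_distrl /=.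
    by apply: eq_bigr => d _; rewrite /w exprMn; ring.
  under eq_cvg do rewrite e.
  by apply: cvgMl; apply: cvgD; exact: cvg_core_poly.
apply: (cvgr_to_ge cv); near=> M.
have KM : (K <= M.+1)%N by apply: leqW; near: M; exact: nbhs_infty_ge.
rewrite !horner_poly (big_ord_widen M.+2
  (fun d => (if (1 < d)%N then w d / d`!%:R else 0) * x ^+ d)) //.
rewrite big_mkcond; apply: ler_sum => d _; case: ifP => // _.
by rewrite mulr_ge0 ?exprn_ge0 //; case: ifP => // _; rewrite divr_ge0.
Unshelve. all: by end_near. Qed.

(** * Estimates at the saddle point *)

(** Jensen for the truncated Poisson distribution of parameter l, whose mean is
    mu: the expectation of (x/l)^d is at least (x/l)^mu.  In other words l
    minimizes g(x)^n / x^k. *)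
Lemma tail_exp_jensen (R : realType) (l x mu : R) n k : 0 < l -> 0 < x ->
  l * (expR l - 1) = mu * tail_exp l -> n%:R * mu = k%:R ->
  (x / l) ^+ k * tail_exp l ^+ n <= tail_exp x ^+ n.
Proof.
move=> l0 x0 hmu nmu; pose L := ln (x / l).
have xl0 : 0 < x / l by rewrite divr_gt0.
have eL : expR L = x / l by rewrite lnK.
have main : expR (mu * L) * tail_exp l <= tail_exp x.
  have cv : (expR (mu * L) * ((1 - mu * L) * (core_poly R K.+1).[l] +
      L * (euler (core_poly R K.+1)).[l]) @[K --> \oo] --> expR (mu * L) * tail_exp l)%classic.
    have -> : tail_exp l = (1 - mu * L) * tail_exp l + L * (l * (expR l - 1)).
      by rewrite hmu; ring.
    apply: cvgMr; apply: cvgD; apply: cvgMr; first exact: cvg_core_poly.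
    exact: cvg_euler_core_poly.
  apply: (ler_cvg_to cv (@cvg_core_poly R x)); near=> K.
  have szg : (size (core_poly R K.+1) <= K.+2)%N by exact: size_poly.
  have sze : (size (euler (core_poly R K.+1)) <= K.+2)%N.
    apply/leq_sizeP => j jK; rewrite coef_euler nth_default ?mul0rn //.
    exact: leq_trans szg jK.
  rewrite !(horner_coef_wide _ szg) (horner_coef_wide _ sze) !big_distrr -big_split big_distrr /=.
  apply: ler_sum => d _; rewrite coef_euler -mulr_natr.
  set c := (core_poly R K.+1)`_d; have c0 : 0 <= c := @core_poly_nneg R _ _.
  have -> : expR (mu * L) * ((1 - mu * L) * (c * l ^+ d) + L * (c * d%:R * l ^+ d)) =
    c * (l ^+ d * (expR (mu * L) * (1 + (d%:R - mu) * L))) by ring.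
  rewrite ler_wpM2l //.
  have -> : x ^+ d = l ^+ d * (expR (mu * L) * expR ((d%:R - mu) * L)).
    rewrite -expRD (_ : mu * L + _ = d%:R * L); last by ring.
    by rewrite expRM_natl eL -exprMn mulrCA divff ?mulr1 // gt_eqF.
  by rewrite ler_wpM2l ?exprn_ge0 ?(ltW l0) // ler_wpM2l ?expR_ge0 // expR_ge1Dx.
have -> : (x / l) ^+ k = expR (mu * L) ^+ n.
  by rewrite -expRM_natl mulrA nmu expRM_natl eL.
rewrite -exprMn lerXn2r ?nnegrE //; last by rewrite ltW // tail_exp_gt0.
by rewrite mulr_ge0 ?expR_ge0 // ltW // tail_exp_gt0.
Unshelve. all: by end_near. Qed.

Lemma expr_bonferroni (R : realFieldType) (d : R) j : 0 <= d <= 1 ->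
  (1 - d) ^+ j <= 1 - j%:R * d + j%:R * (j%:R - 1) / 2 * d ^+ 2.
Proof.
move=> /andP[d0 d1]; elim: j => [|j IH]; first by rewrite expr0 !mul0r; lra.
rewrite exprS; apply: le_trans (ler_wpM2l _ IH) _; first by rewrite subr_ge0.
rewrite -subr_ge0 -[j.+1]addn1 natrD.
have -> : 1 - (j%:R + 1) * d + (j%:R + 1) * (j%:R + 1 - 1) / 2 * d ^+ 2 -
   (1 - d) * (1 - j%:R * d + j%:R * (j%:R - 1) / 2 * d ^+ 2) =
   j%:R * (j%:R - 1) / 2 * d ^+ 3 :> R by field.
rewrite mulr_ge0 ?exprn_ge0 // divr_ge0 //.
by case: j {IH} => [|j]; rewrite ?mul0r // mulr_ge0 // subr_ge0 ler1n.
Qed.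

(** Write t^d = t^2 (1-(1-t))^(d-2) and apply Bonferroni.  The bound is a
    polynomial of degree 2 in d, so its expectation only involves the first two
    moments; the coefficients come from (d-2)(d-3) = d^2 - 5d + 6. *)
Lemma tail_exp_scale_le (R : realType) (l t : R) : 0 <= l -> 0 <= t <= 1 ->
  tail_exp (t * l) <= t ^+ 2 * ((1 + 2 * (1 - t) + 3 * (1 - t) ^+ 2) * tail_exp l -
    (1 - t + 5 / 2 * (1 - t) ^+ 2) * (l * (expR l - 1)) +
    (1 - t) ^+ 2 / 2 * (l ^+ 2 * expR l + l * (expR l - 1))).
Proof.
move=> l0 /andP[t0 t1].
have cv := @cvg_core_poly R (t * l); have c0 := @cvg_core_poly R l.
have c1 := @cvg_euler_core_poly R l; have c2 := @cvg_euler2_core_poly R l.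
pose a := (1 + 2 * (1 - t) + 3 * (1 - t) ^+ 2).
pose b := (1 - t + 5 / 2 * (1 - t) ^+ 2).
pose c := (1 - t) ^+ 2 / 2.
have cw : (t ^+ 2 * (a * (core_poly R K.+1).[l] - b * (euler (core_poly R K.+1)).[l] +
    c * (euler (euler (core_poly R K.+1))).[l]) @[K --> \oo] -->
    t ^+ 2 * (a * tail_exp l - b * (l * (expR l - 1)) +
    c * (l ^+ 2 * expR l + l * (expR l - 1))))%classic.
  by apply: cvgMr; apply: cvgD; [apply: cvgB|]; apply: cvgMr.
apply: (ler_cvg_to cv cw); near=> K.
have szg : (size (core_poly R K.+1) <= K.+2)%N by exact: size_poly.
have sze (p : {poly R}) : (size p <= K.+2)%N -> (size (euler p) <= K.+2)%N.
  move=> sp; apply/leq_sizeP => j jK; rewrite coef_euler nth_default ?mul0rn //.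
  exact: leq_trans sp jK.
rewrite /= !(horner_coef_wide _ szg) (horner_coef_wide _ (sze _ szg)).
rewrite (horner_coef_wide _ (sze _ (sze _ szg))) !big_distrr -sumrB -big_split big_distrr /=.
have e1 (p : {poly R}) j : (euler p)`_j = p`_j * j%:R by rewrite coef_euler mulr_natr.
apply: ler_sum => d _; rewrite !e1 -!(mulrA _ d%:R d%:R) coef_core_poly.
case: ifP => [/andP[d2 _]|_]; last by rewrite !mul0r !mulr0 subrr addr0 mulr0.
case: (d : nat) d2 => [|[|e]] // _.
have := @expr_bonferroni _ (1 - t) e; rewrite subr_ge0 lerBlDr lerDl t0 t1 => /(_ isT).
rewrite subKr => h; rewrite exprMn.
set f := _^-1; have f0 : 0 <= f by rewrite invr_ge0.
have -> : t ^+ 2 * (a * (f * l ^+ e.+2) - b * (f * e.+2%:R * l ^+ e.+2) +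
   c * (f * (e.+2%:R * e.+2%:R) * l ^+ e.+2)) =
   f * (t ^+ 2 * l ^+ e.+2) * (1 - e%:R * (1 - t) + e%:R * (e%:R - 1) / 2 * (1 - t) ^+ 2).
  by rewrite /a /b /c -[e.+2]addn2 natrD; field.
have -> : f * (t ^+ e.+2 * l ^+ e.+2) = f * (t ^+ 2 * l ^+ e.+2) * t ^+ e.
  by rewrite -[in t ^+ _]addn2 exprD; ring.
rewrite ler_wpM2l // mulr_ge0 // mulr_ge0 //; exact: exprn_ge0.
Unshelve. all: by end_near. Qed.

(** The parameter l for which the truncated Poisson distribution, with weights
    l^d / d! for d >= 2, has mean 2 + nu. *)
Definition saddle (R : realType) (nu l : R) : Prop :=
  l * (expR l - 1) = (2 + nu) * tail_exp l.

Lemma saddle_sqr (R : realType) (nu l : R) : saddle nu l ->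
  l ^+ 2 = (2 + nu - l) * tail_exp l.
Proof. by rewrite /saddle /tail_exp => h; nra. Qed.

Lemma saddle_ge (R : realType) (nu l : R) : 0 < l -> saddle nu l -> nu <= l.
Proof.
move=> l0 /saddle_sqr h; have g0 := tail_exp_gt0 l0.
have := tail_exp_lower (ltW l0).
have -> : l ^+ 2 / 2 = (2 + nu - l) / 2 * tail_exp l by rewrite h; ring.
by rewrite -[leRHS]mul1r ler_pM2r //; lra.
Qed.

Lemma tail_exp_upper3 (R : realType) (l : R) : 0 <= l ->
  (1 - l / 3) * tail_exp l <= l ^+ 2 / 2.
Proof.
move=> l0; have := exp_remainder_le 2 l0.
rewrite !exp_sumS /exp_sum big_ord0 !factS fact0 !muln1 expr0 expr1 /tail_exp.
by lra.
Qed.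

Lemma tail_exp_upper5 (R : realType) (l : R) : 0 <= l ->
  (1 - l / 5) * (tail_exp l - l ^+ 2 / 2 - l ^+ 3 / 6) <= l ^+ 4 / 24.
Proof.
move=> l0; have := exp_remainder_le 4 l0.
rewrite !exp_sumS /exp_sum big_ord0 !factS fact0 !muln1 expr0 expr1 /tail_exp.
have -> : (4 * (3 * 2))%N = 24%N by [].
have -> : (3 * 2)%N = 6%N by [].
by lra.
Qed.

(** Intermediate values: the mean is at most 2 + nu at l = nu because g(l) is at
    least l^2 / 2, and at least 2 + nu at l = 3 nu because
    (1 - l/3) g(l) <= l^2 / 2. *)
Lemma exists_saddle (R : realType) (nu : R) : 0 < nu < 1 ->
  exists2 l : R, nu <= l <= 3 * nu & saddle nu l.
Proof.
move=> /andP[n0 n1].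
pose h (l : R) := l * (expR l - 1) - (2 + nu) * tail_exp l.
have hE l : h l = (l - 2 - nu) * tail_exp l + l ^+ 2 by rewrite /h /tail_exp; ring.
have ch : continuous h.
  move=> x; apply: cvgB.
    apply: cvgM; first exact: cvg_id.
    by apply: cvgB; [exact: continuous_expR|exact: cvg_cst].
  apply: cvgM; first exact: cvg_cst.
  apply: cvgB; last exact: cvg_id.
  by apply: cvgB; [exact: continuous_expR|exact: cvg_cst].
have h1 : h nu <= 0 by rewrite hE; have := tail_exp_lower (ltW n0); lra.
have h2 : 0 <= h (3 * nu).
  have n3 : 0 <= 3 * nu by lra.
  rewrite hE; have := tail_exp_upper3 n3; set g := tail_exp _; lra.
have n13 : nu <= 3 * nu by lra.
have [||l] := @IVT R h nu (3 * nu) 0 n13.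
- exact: continuous_subspaceT.
- by rewrite ge_min h1 le_max h2 orbT.
rewrite in_itv /= => lin hl0; exists l => //.
by rewrite /saddle; apply/eqP; rewrite -subr_eq0 -/(h l) hl0.
Qed.

(** The left-hand side is the expectation of (d-2)(d-3) under the truncated
    Poisson distribution. *)
Lemma saddle_bound (R : realType) (nu l : R) : 0 < l <= 3 -> nu <= 1 -> saddle nu l ->
  l * (1 + nu) - 3 * nu <= 3 / 2.
Proof.
move=> /andP[l0 l3] n1 sl; have hs := saddle_sqr sl; have g0 := tail_exp_gt0 l0.
have nl : 0 < 2 + nu - l by rewrite -(pmulr_lgt0 _ g0) -hs exprn_gt0.
(* Bounding the terms of g from degree 4 on by a geometric series turns the
   saddle equation into a rational lower bound for nu. *)
have nuB : l * (l ^+ 2 + 6 * l + 20) <= nu * (l ^+ 2 + 8 * l + 60).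
  have g5 : tail_exp l * (24 * (5 - l)) <= l ^+ 2 * (60 + 8 * l + l ^+ 2).
    by have := tail_exp_upper5 (ltW l0); lra.
  have : tail_exp l * (24 * (5 - l)) <= tail_exp l * ((2 + nu - l) * (60 + 8 * l + l ^+ 2)).
    apply: le_trans g5 _.
    by have -> : tail_exp l * ((2 + nu - l) * (60 + 8 * l + l ^+ 2)) =
      l ^+ 2 * (60 + 8 * l + l ^+ 2) by rewrite hs; ring.
  by rewrite ler_pM2l //; lra.
have l2 : l <= 109 / 50.
  rewrite leNgt; apply/negP => lb; nra.
have D0 : 0 < l ^+ 2 + 8 * l + 60 by have := sqr_ge0 l; lra.
have h : (l ^+ 2 + 8 * l + 60) * (l - 3 / 2) <= (l ^+ 2 + 8 * l + 60) * (nu * (3 - l)).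
  apply: (@le_trans _ _ (l * (l ^+ 2 + 6 * l + 20) * (3 - l))).
    rewrite -subr_ge0; have -> : l * (l ^+ 2 + 6 * l + 20) * (3 - l) -
      (l ^+ 2 + 8 * l + 60) * (l - 3 / 2) =
      90 + 12 * l - 17 / 2 * l ^+ 2 - 4 * l ^+ 3 - l ^+ 4 by field.
    have q2 : l ^+ 2 <= 109 / 50 * l by rewrite expr2 ler_wpM2r // ltW.
    have q3 : l ^+ 3 <= 109 / 50 * l ^+ 2 by rewrite exprS ler_wpM2r // exprn_ge0 // ltW.
    have q4 : l ^+ 4 <= 109 / 50 * l ^+ 3 by rewrite exprS ler_wpM2r // exprn_ge0 // ltW.
    lra.
  have -> : (l ^+ 2 + 8 * l + 60) * (nu * (3 - l)) = nu * (l ^+ 2 + 8 * l + 60) * (3 - l) by ring.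
  by rewrite ler_wpM2r // subr_ge0.
by move: h; rewrite ler_pM2l //; lra.
Qed.

(** The even terms of g(-u) and g(u) agree and the odd ones differ in sign; the
    cubic terms account for the gap. *)
Lemma tail_expN_le (R : realType) (u : R) : 0 <= u ->
  tail_exp (- u) <= tail_exp u - u ^+ 3 / 3.
Proof.
move=> u0; have cv : ((core_poly R K.+1).[u] - u ^+ 3 / 3 @[K --> \oo] -->
    tail_exp u - u ^+ 3 / 3)%classic.
  by apply: cvgB; [exact: cvg_core_poly|exact: cvg_cst].
apply: (ler_cvg_to (@cvg_core_poly R (- u)) cv); near=> K.
have K2 : (1 < K)%N by near: K; exact: nbhs_infty_gt.
rewrite !horner_core_gf lerBrDr (bigD1 (Ordinal K2)) //= [leRHS](bigD1 (Ordinal K2)) //=.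
have -> : (3`! = 6)%N by [].
have ab d : (- u) ^+ d <= u ^+ d.
  by rewrite (le_trans (ler_norm _)) // normrX normrN ger0_norm.
rewrite addrAC lerD //; first by rewrite !(exprS (- u)) expr0 !(exprS u) expr0; lra.
apply: ler_sum => d _; apply: ler_wpM2l (ab _); exact: divr_ge0.
Unshelve. all: by end_near. Qed.

(** Since g(-u) <= g(u), only |t| matters, and tail_exp_scale_le applies with
    the expectation of (d-2)(d-3) bounded by 3/2. *)
Lemma tail_exp_ratio_le (R : realType) (nu l t : R) : 0 < l <= 3 -> 0 <= nu <= 1 ->
  saddle nu l -> -1 <= t <= 1 ->
  tail_exp (t * l) <=
  `|t| ^+ 2 * (1 - nu * (1 - `|t|) + 3 / 4 * (1 - `|t|) ^+ 2) * tail_exp l.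
Proof.
move=> l03 /andP[n0 n1] sl; have [l0 l3] := andP l03 => t1.
have a1 : 0 <= `|t| <= 1 by rewrite normr_ge0 ler_norml.
have sym : tail_exp (t * l) <= tail_exp (`|t| * l).
  have [t0|/ltW t0] := leP 0 t; first by rewrite ger0_norm.
  rewrite ler0_norm //; set u := - t * l.
  have u0 : 0 <= u by rewrite mulr_ge0 ?(ltW l0) // oppr_ge0.
  have -> : t * l = - u by rewrite /u; ring.
  by have := tail_expN_le u0; have := exprn_ge0 3 u0; lra.
apply: le_trans sym _; apply: le_trans (tail_exp_scale_le (ltW l0) a1) _.
move: (`|t|) a1 => {t1}t /andP[t0 t1].
have g0 := tail_exp_gt0 l0; rewrite -[leRHS]mulrA ler_wpM2l ?sqr_ge0 //.
(* Second moment at the saddle point, as a multiple of g(l). *)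
have hs := saddle_sqr sl; have hb := saddle_bound l03 n1 sl.
have e2 : l ^+ 2 * expR l = (l * (2 + nu) + (2 + nu - l)) * tail_exp l.
  by rewrite mulrDl -hs -[l * (2 + nu) * _]mulrA -sl; ring.
rewrite sl e2 -!mulrDl !mulrA -mulrBl -mulrDl ler_wpM2r ?(ltW g0) //.
by have := sqr_ge0 (1 - t); nra.
Qed.

(** * The polynomial inequality for the middle range *)

(** The contribution of nu = 0 to the convex combination in gap_ineq.  Using
    w^2 = (1-t)(1+t) to eliminate 1-t, the inequality can be divided by w^3. *)
Lemma gap_ineq0 (R : realFieldType) (t w b : R) : 0 <= t <= 1 -> 0 <= w ->
  t ^+ 2 + w ^+ 2 = 1 -> b = (3 * w ^+ 2 - w ^+ 3) / 4 ->
  w ^+ 3 / 4 <= w ^+ 3 - w ^+ 2 * b - t ^+ 2 * (1 - t) ^+ 2 * (9 + b) / 4.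
Proof.
move=> /andP[t0 t1] w0 tw bE.
have w1 : w <= 1 by nra.
have wt : w <= 1 - t ^+ 2 / 2 by nra.
have b2 : b <= 1 / 2 by rewrite bE; nra.
(* The claim divided by w^3 and multiplied by (1+t)^2 reduces to key, and
   bounding w by 1 - t^2/2 makes it a polynomial inequality in t. *)
have poly : 19 * t ^+ 2 * (1 - t ^+ 2 / 2) <= (2 + t ^+ 2) * (1 + t) ^+ 2.
  have e : (2 + t ^+ 2) * (1 + t) ^+ 2 - 19 * t ^+ 2 * (1 - t ^+ 2 / 2) =
    2 + 4 * t - 16 * t ^+ 2 + 2 * t ^+ 3 + 21 / 2 * t ^+ 4 by field.
  rewrite -subr_ge0 e.
  have := sqr_ge0 (t ^+ 2 + t * (2/21) - 3 / 5); have := sqr_ge0 (t - 73/100).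
  nra.
have key : w * t ^+ 2 * (9 + b) / 4 <= (1 + t) ^+ 2 * (3 / 4 * (1 - w) + w ^+ 2 / 4).
  have h1 : w * t ^+ 2 * (9 + b) / 4 <= 19 / 8 * t ^+ 2 * (1 - t ^+ 2 / 2).
    have : w * (9 + b) <= (1 - t ^+ 2 / 2) * (19 / 2).
      by apply: ler_pM => //; rewrite ?bE; nra.
    by have := sqr_ge0 t; nra.
  have h2 : 1 / 4 + t ^+ 2 / 8 <= 3 / 4 * (1 - w) + w ^+ 2 / 4 by lra.
  apply: le_trans h1 _; apply: le_trans (_ : (1 + t) ^+ 2 * (1 / 4 + t ^+ 2 / 8) <= _); first lra.
  by rewrite ler_wpM2l ?sqr_ge0.
have dt : w ^+ 2 = (1 - t) * (1 + t) by lra.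
have t10 : 0 < (1 + t) ^+ 2 by rewrite exprn_gt0 //; lra.
rewrite -(ler_pM2l t10) -subr_ge0.
have -> : (1 + t) ^+ 2 * (w ^+ 3 - w ^+ 2 * b - t ^+ 2 * (1 - t) ^+ 2 * (9 + b) / 4) -
    (1 + t) ^+ 2 * (w ^+ 3 / 4) =
  w ^+ 3 * ((1 + t) ^+ 2 * (3 / 4 * (1 - w) + w ^+ 2 / 4) - w * t ^+ 2 * (9 + b) / 4) +
  (t ^+ 2 * (9 + b) / 4) * ((w ^+ 2) ^+ 2 - ((1 - t) * (1 + t)) ^+ 2).
  by rewrite bE; field.
have -> : (w ^+ 2) ^+ 2 - ((1 - t) * (1 + t)) ^+ 2 = 0 by rewrite dt subrr.
by rewrite mulr0 addr0 mulr_ge0 ?exprn_ge0 // subr_ge0.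
Qed.

(** The contribution of nu = 1.  With b bounded by 3 w^2 / 4 in the last term,
    the claim reads (1-t)^2 q <= w^3 for a polynomial q in t.  As
    w^2 = (1-t)(1+t), a factor 1-t cancels and squaring removes w. *)
Lemma gap_ineq1 (R : realFieldType) (t w b : R) : 0 <= t <= 1 -> 0 <= w ->
  t ^+ 2 + w ^+ 2 = 1 -> b = (3 * w ^+ 2 - w ^+ 3) / 4 ->
  0 <= 3 * (1 - t ^+ 2 * (t + 3 / 4 * (1 - t) ^+ 2) - 2 * b) - t ^+ 3 * (1 - t) * b.
Proof.
move=> /andP[t0 t1] w0 tw bE.
have dt : w ^+ 2 = (1 - t) * (1 + t) by lra.
pose q := 1 + 2 * t + 3 / 2 * t ^+ 2 + (t ^+ 3 + t ^+ 4) / 2.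
have q0 : 0 <= q by rewrite /q !addr_ge0 ?mulr_ge0 ?exprn_ge0 ?addr_ge0 ?exprn_ge0.
have h : (1 - t) * q <= w * (1 + t).
  suff : ((1 - t) * q) ^+ 2 <= (w * (1 + t)) ^+ 2.
    rewrite ler_pXn2r // nnegrE; first by rewrite mulr_ge0 ?subr_ge0.
    by rewrite mulr_ge0 // addr_ge0.
  rewrite !exprMn dt.
  have : (1 - t) * q ^+ 2 <= (1 + t) ^+ 3.
    have e : (1 + t) ^+ 3 - (1 - t) * q ^+ 2 = t ^+ 3 *
      (1 + 7 / 4 * t + 7 / 4 * t ^+ 2 + 7 / 4 * t ^+ 3 +
       5 / 4 * t ^+ 4 + 1 / 4 * t ^+ 5 + 1 / 4 * t ^+ 6).
      by rewrite /q; field.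
    rewrite -subr_ge0 e mulr_ge0 ?exprn_ge0 //.
    by rewrite !addr_ge0 ?mulr_ge0 ?exprn_ge0.
  move=> /(ler_wpM2l (_ : 0 <= 1 - t)); rewrite subr_ge0 => /(_ t1); lra.
have bU : b <= 3 / 4 * w ^+ 2 by have := exprn_ge0 3 w0; lra.
have hb : t ^+ 3 * (1 - t) * b <= t ^+ 3 * (1 - t) * (3 / 4 * w ^+ 2).
  by rewrite ler_wpM2l // mulr_ge0 ?exprn_ge0 // subr_ge0.
have w3 : (1 - t) ^+ 2 * q <= w ^+ 3.
  have -> : w ^+ 3 = (1 - t) * (w * (1 + t)) by rewrite exprSr dt; ring.
  by rewrite expr2 -mulrA ler_wpM2l // subr_ge0.
have e : (1 - t) ^+ 2 * q = 1 - 3 / 2 * t ^+ 2 - t ^+ 3 + 3 / 2 * t ^+ 4 +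
    t ^+ 3 * (1 - t) * (1 - t ^+ 2) / 2.
  by rewrite /q; field.
have w2 : w ^+ 2 = 1 - t ^+ 2 by lra.
rewrite w2 in bE hb *; rewrite bE in hb *; rewrite e in w3.
lra.
Qed.

(** With r replaced by its upper bound, the right-hand side is a quadratic
    polynomial in nu with leading coefficient t^2 (1-t) b >= 0.  Since
    nu^2 >= (1-t)(2 nu - 1), it is at least a convex combination, with weights
    1 - nu and nu, of the two quantities of gap_ineq0 and gap_ineq1. *)
Lemma gap_ineq (R : realFieldType) (t w b nu r : R) : 0 <= t <= 1 -> 0 <= w ->
  t ^+ 2 + w ^+ 2 = 1 -> b = (3 * w ^+ 2 - w ^+ 3) / 4 -> 0 <= nu <= 1 ->
  r <= t ^+ 2 * (1 - nu * (1 - t) + 3 / 4 * (1 - t) ^+ 2) ->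
  (1 - nu) * w ^+ 3 / 4 <= (1 - r) * (3 - (1 - nu) * b) - 2 * (2 + nu) * b.
Proof.
move=> t01 w0 tw bE /andP[n0 n1] rle.
have h0 := gap_ineq0 t01 w0 tw bE; have h1 := gap_ineq1 t01 w0 tw bE.
have [t0 t1] := andP t01.
have w1 : w <= 1 by nra.
have b0 : 0 <= b by rewrite bE; nra.
have b1 : b <= 1 by rewrite bE; nra.
set s := t ^+ 2 * _ in rle.
have : (1 - s) * (3 - (1 - nu) * b) <= (1 - r) * (3 - (1 - nu) * b).
  by rewrite ler_wpM2r ?lerB //; nra.
move=> H.
suff : (1 - nu) * w ^+ 3 / 4 <= (1 - s) * (3 - (1 - nu) * b) - 2 * (2 + nu) * b by lra.
have -> : (1 - s) * (3 - (1 - nu) * b) - 2 * (2 + nu) * b =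
  (1 - nu) * (w ^+ 3 - w ^+ 2 * b - t ^+ 2 * (1 - t) ^+ 2 * (9 + b) / 4) +
  nu * (3 * (1 - t ^+ 2 * (t + 3 / 4 * (1 - t) ^+ 2) - 2 * b) - t ^+ 3 * (1 - t) * b) +
  t ^+ 2 * (1 - t) * b * (nu ^+ 2 - 2 * (1 - t) * nu + (1 - t)).
  have w2 : w ^+ 2 = 1 - t ^+ 2 by lra.
  have w3 : w ^+ 3 = 3 * (1 - t ^+ 2) - 4 * b by rewrite bE w2; field.
  by rewrite w3 w2 /s; field.
rewrite -[leLHS]addr0 lerD //.
  rewrite -[leLHS]addr0 lerD ?mulr_ge0 //.
  by rewrite -mulrA ler_wpM2l // subr_ge0.
rewrite !mulr_ge0 ?exprn_ge0 ?subr_ge0 //.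
by have := sqr_ge0 (nu - (1 - t)); nra.
Qed.

(** A rearrangement of gap_ineq that isolates the strict gain
    (1-nu) w^3 / 24. *)
Lemma gap_product (R : realFieldType) (t w b nu r : R) : 0 <= t <= 1 -> 0 <= w ->
  t ^+ 2 + w ^+ 2 = 1 -> b = (3 * w ^+ 2 - w ^+ 3) / 4 -> 0 <= nu <= 1 ->
  r <= t ^+ 2 * (1 - nu * (1 - t) + 3 / 4 * (1 - t) ^+ 2) ->
  (1 - (1 - nu) / 3 * b) * ((1 + r) / 2) <= (1 - b) * (1 - (1 - nu) * w ^+ 3 / 24).
Proof.
move=> t01 w0 tw bE nu01 rle; have := gap_ineq t01 w0 tw bE nu01 rle.
have [n0 n1] := andP nu01; set eta := (1 - nu) * w ^+ 3 / 24 => ineq.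
have w1 : w <= 1 by have := sqr_ge0 t; nra.
have b0 : 0 <= b by rewrite bE; nra.
have eta0 : 0 <= eta by rewrite divr_ge0 // mulr_ge0 ?exprn_ge0 ?subr_ge0.
apply: (@le_trans _ _ (1 - b - eta)); first by rewrite /eta; lra.
by rewrite mulrBr mulr1 lerD2l lerN2 ler_piMl //; lra.
Qed.

(** * First moment of the dependent sets of slots *)

(** The lower bound on the number of 2-cores, moved from the mode to the saddle
    point. *)
Lemma core_poly_count_lower (R : realType) n k (l mu : R) :
  (0 < n)%N -> (2 * n < k <= 3 * n)%N -> 0 < l ->
  l * (expR l - 1) = mu * tail_exp l -> n%:R * mu = k%:R ->
  tail_exp l ^+ n <= 38 * Num.sqrt n%:R * ((core_poly R k ^+ n)`_k * l ^+ k).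
Proof.
move=> n0 nk l0 hmu nmu.
have [x /andP[x0 x3] hx] := @coef_core_poly_lower R n k n0 nk.
set a := 38 * _ in hx *; set c := (core_poly R k ^+ n)`_k in hx *.
have lim : tail_exp x ^+ n <= a * (c * x ^+ k).
  have cv : ((core_poly R K.+1).[x] ^+ n @[K --> \oo] --> tail_exp x ^+ n)%classic.
    elim: (n) => [|j IH]; first by under eq_cvg do rewrite expr0; exact: cvg_cst.
    by under eq_cvg do rewrite exprS; rewrite exprS; apply: cvgM => //; exact: cvg_core_poly.
  apply: (cvgr_to_le cv); near=> K; apply: hx.
  by apply: leqW; near: K; exact: nbhs_infty_ge.
have := le_trans (tail_exp_jensen l0 x0 hmu nmu) lim.
rewrite exprMn exprVn mulrAC ler_pdivrMr ?exprn_gt0 // => h.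
rewrite -(ler_pM2l (exprn_gt0 k x0)); apply: le_trans h _.
by rewrite le_eqVlt; apply/orP; left; apply/eqP; ring.
Unshelve. all: by end_near. Qed.

(** Upper bound for the average over random sets of slots divided by the lower
    bound for the number of 2-cores.  The parameter p is free. *)
Lemma even_core_bound (R : realType) (T I : finType) n k (l mu p : R) (s : {set T}) :
  #|T| = k -> #|I| = n -> (0 < n)%N -> (2 * n < k <= 3 * n)%N -> 0 < l ->
  l * (expR l - 1) = mu * tail_exp l -> n%:R * mu = k%:R -> 0 < p < 1 ->
  'C(k, #|s|)%:R * (p ^+ #|s| * (1 - p) ^+ (k - #|s|)) *
    #|[set f in core_fun T I | even_on f s]|%:R <=
  38 * Num.sqrt n%:R * ((1 + tail_exp ((1 - p *+ 2) * l) / tail_exp l) / 2) ^+ n *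
  #|core_fun T I|%:R.
Proof.
move=> Tk In n0 nk l0 hmu nmu /andP[p0 p1].
have p01 : 0 <= p <= 1 by rewrite !ltW.
have := @card_even_core_le R T I s p p01; rewrite Tk => h; apply: le_trans h _.
rewrite (@weighted_core_count R T I (fun d => (1 + (1 - p *+ 2) ^+ d) / 2) k) ?Tk // In.
rewrite (@card_core_fun R T I k) ?Tk // In.
set w := (fun d => _); set t := 1 - p *+ 2 in w *.
rewrite -[leLHS]mulr_natr -[X in _ <= _ * X]mulr_natr mulrA ler_wpM2r ?ler0n //.
have g0 := tail_exp_gt0 l0.
rewrite -(ler_pM2r (exprn_gt0 k l0)).
have t1 : -1 <= t <= 1 by rewrite /t mulr2n; apply/andP; split; lra.
have w0 d : 0 <= w d := avg_sign_ge0 d t1.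
have cn : nneg_poly (core_gf w k).
  move=> d; rewrite coef_poly; case: ifP => // _; case: ifP => // _.
  by rewrite divr_ge0.
apply: le_trans (coef_le_horner k (nneg_polyX n cn) (ltW l0)) _.
rewrite horner_exp.
apply: (@le_trans _ _ (((tail_exp l + tail_exp (t * l)) / 2) ^+ n)).
  have hor0 : 0 <= (core_gf w k).[l].
    by apply: le_trans (coef_le_horner 0 cn (ltW l0)); rewrite mulr_ge0 ?exprn_ge0 // ltW.
  have hle := @core_gf_sign_le R t l k t1 (ltW l0).
  by rewrite lerXn2r ?nnegrE // (le_trans hor0).
have -> : (tail_exp l + tail_exp (t * l)) / 2 =
    tail_exp l * ((1 + tail_exp (t * l) / tail_exp l) / 2).
  by field; rewrite gt_eqF.
have tl0 : 0 <= tail_exp (t * l) by have := expR_ge1Dx (t * l); rewrite /tail_exp; lra.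
have r0 : 0 <= (1 + tail_exp (t * l) / tail_exp l) / 2.
  by rewrite divr_ge0 // addr_ge0 // divr_ge0 // ltW.
rewrite exprMn [leRHS]mulrAC [X in _ <= X * _]mulrAC -[leRHS]mulrA [leRHS]mulrC.
apply: le_trans (ler_wpM2r (exprn_ge0 n r0) (core_poly_count_lower n0 nk l0 hmu nmu)) _.
by rewrite le_eqVlt; apply/orP; left; apply/eqP; ring.
Qed.

(** * Optimizing the first moment bound *)

Lemma expRN_le_quad (R : realType) (d : R) : 0 <= d -> expR (- d) <= 1 - d + d ^+ 2 / 2.
Proof.
move=> d0; rewrite expRN.
have h : 1 + d + d ^+ 2 / 2 <= expR d.
  by have := tail_exp_lower d0; rewrite /tail_exp; lra.
have q : 0 < 1 + d + d ^+ 2 / 2 by have := sqr_ge0 d; lra.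
apply: (@le_trans _ _ (1 + d + d ^+ 2 / 2)^-1); first by rewrite lef_pV2 ?posrE ?expR_gt0.
rewrite -[leLHS]mul1r ler_pdivrMr //.
by rewrite -subr_ge0 (_ : _ - _ = (d ^+ 2) ^+ 2 / 4) ?divr_ge0 ?sqr_ge0 //; field.
Qed.

Lemma inv1B_le_exp (R : realType) (p : R) : 0 <= p <= 1 / 2 -> 1 <= (1 - p) * expR (p + 2 * p ^+ 2).
Proof.
move=> /andP[p0 p2].
apply: (@le_trans _ _ ((1 - p) * (1 + (p + 2 * p ^+ 2)))); first nra.
by rewrite ler_wpM2l ?expR_ge1Dx //; lra.
Qed.

Lemma tail_exp_taylor (R : realType) (l d : R) : 0 <= d ->
  tail_exp (l - d) <= tail_exp l - d * (expR l - 1) + d ^+ 2 / 2 * expR l.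
Proof.
move=> d0; rewrite /tail_exp expRD.
by have := ler_wpM2l (expR_ge0 l) (expRN_le_quad d0); lra.
Qed.

Lemma bin_ge_pow (R : realFieldType) m s : (0 < s <= m)%N ->
  (m%:R / s%:R) ^+ s <= 'C(m, s)%:R :> R.
Proof.
elim: s m => // s IH [|m] //= sm; rewrite ltnS in sm.
have [->|s0] := posnP s; first by rewrite bin1 expr1 divr1.
have h : s.+1%:R * 'C(m.+1, s.+1)%:R = m.+1%:R * 'C(m, s)%:R :> R.
  by rewrite -!natrM mul_bin_diag.
have S0 : 0 < s.+1%:R :> R by rewrite ltr0n.
have -> : 'C(m.+1, s.+1)%:R = m.+1%:R / s.+1%:R * 'C(m, s)%:R :> R.
  by rewrite mulrAC -h mulrAC divff ?mul1r // gt_eqF.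
rewrite exprS ler_wpM2l ?divr_ge0 //.
apply: le_trans (IH m _); last by rewrite s0.
rewrite lerXn2r ?nnegrE ?divr_ge0 //.
rewrite ler_pdivrMr // mulrAC ler_pdivlMr ?ltr0n // -!natrM ler_nat; nia.
Qed.

(** With success probability s/m the binomial distribution has its mode at s, and
    the m+1 probabilities add up to 1. *)
Lemma bin_mode (R : realFieldType) m s : (0 < s < m)%N ->
  1 <= m.+1%:R * ('C(m, s)%:R * ((s%:R / m%:R) ^+ s * (1 - s%:R / m%:R) ^+ (m - s))) :> R.
Proof.
move=> /andP[s0 sm]; have m0 : (0 < m)%N by exact: leq_trans sm.
pose a : R := s%:R / m%:R.
have M0 : 0 < m%:R :> R by rewrite ltr0n.
have a0 : 0 < a by rewrite divr_gt0 ?ltr0n.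
have aE : 1 - a = (m - s)%:R / m%:R by rewrite natrB ?(ltnW sm) // mulrBl divff ?gt_eqF.
have a1 : 0 < 1 - a by rewrite aE divr_gt0 ?ltr0n ?subn_gt0.
pose F j : R := 'C(m, j)%:R * (a ^+ j * (1 - a) ^+ (m - j)).
have step j : (j < m)%N -> F j.+1 * (j.+1%:R * (m - s)%:R) = F j * ((m - j)%:R * s%:R).
  move=> jm; have h : j.+1%:R * 'C(m, j.+1)%:R = (m - j)%:R * 'C(m, j)%:R :> R.
    by rewrite -!natrM mul_bin_left.
  have e1 : (m - s)%:R = (1 - a) * m%:R by rewrite aE divfK // gt_eqF.
  have e2 : s%:R = a * m%:R by rewrite /a divfK // gt_eqF.
  rewrite /F e1 e2.
  have e3 : (1 - a) ^+ (m - j) = (1 - a) * (1 - a) ^+ (m - j.+1) by rewrite -exprS subnSK.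
  rewrite e3 exprS; move: h; set C1 := 'C(m, j.+1)%:R; set C0 := 'C(m, j)%:R => h.
  transitivity ((j.+1%:R * C1) *
    (a * a ^+ j * (1 - a) ^+ (m - j.+1) * ((1 - a) * m%:R))); first by ring.
  by rewrite h; ring.
have F0 j : 0 <= F j by rewrite mulr_ge0 ?mulr_ge0 ?exprn_ge0 ?(ltW a0) ?(ltW a1).
have up j : (j < s)%N -> F j <= F j.+1.
  move=> js; have jm := ltn_trans js sm.
  have P0 : 0 < j.+1%:R * (m - s)%:R :> R by rewrite -natrM ltr0n muln_gt0 subn_gt0.
  rewrite -(ler_pM2r P0) step // ler_wpM2l // -!natrM ler_nat; nia.
have down j : (s <= j)%N -> F j.+1 <= F j.
  move=> sj; have [jm|mj] := ltnP j m; last by rewrite {1}/F bin_small // mul0r F0.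
  have P0 : 0 < j.+1%:R * (m - s)%:R :> R by rewrite -natrM ltr0n muln_gt0 subn_gt0.
  rewrite -(ler_pM2r P0) step // ler_wpM2l // -!natrM ler_nat; nia.
have mode j : F j <= F s.
  have [js|sj] := leqP j s.
    by rewrite -(subKn js); elim: (s - j)%N => [|d IH]; [rewrite subn0|
      apply: le_trans IH; have [sd|ds] := leqP s d;
      [rewrite (_ : s - d.+1 = s - d)%N //; lia|
       rewrite -[X in _ <= F X]subnSK //; apply: up; lia]].
  by rewrite -(subnKC (ltnW sj)); elim: (j - s)%N => [|d IH];
    [rewrite addn0|rewrite addnS (le_trans _ IH) // down ?leq_addr].
have tot : \sum_(j < m.+1) F j = 1.
  have := exprDn (1 - a) a m; rewrite subrK expr1n => ->.
  by apply: eq_bigr => j _; rewrite /F mulr_natl [a ^+ _ * _]mulrC.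
rewrite -[leLHS]tot; apply: (@le_trans _ _ (\sum_(j < m.+1) F s)); first exact: ler_sum.
by rewrite sumr_const card_ord mulr_natl.
Qed.

(** The shape of the first moment estimate: e s stands for the expected number
    of dependent sets of s rows, and p remains to be chosen. *)
Definition row_bound (R : realType) (m n : nat) (l : R) (e : nat -> R) : Prop :=
  forall s p, (0 < s <= m)%N -> 0 < p < 1 ->
  'C(m, s)%:R ^+ 2 * (p ^+ s * (1 - p) ^+ (m - s)) ^+ 3 * e s <=
  38 * Num.sqrt n%:R * ((1 + tail_exp ((1 - p *+ 2) * l) / tail_exp l) / 2) ^+ n.

Lemma avg_ratio_ge0 (R : realType) (l t : R) : 0 < l ->
  0 <= (1 + tail_exp (t * l) / tail_exp l) / 2.
Proof.
move=> l0; rewrite divr_ge0 // addr_ge0 // divr_ge0 //.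
  by have := expR_ge1Dx (t * l); rewrite /tail_exp; lra.
by rewrite ltW // tail_exp_gt0.
Qed.

(** Take p = sqrt(s/m).  Then 'C(m,s) is at least p^(-2s), so that the weight of
    e s is about p^(-s); the terms of first order in p cancel by the choice of
    the saddle point, and those of second order are n p^2 = O(s). *)
Lemma small_row_sets (R : realType) (m n : nat) (nu l : R) (e : nat -> R) s :
  (2 * n <= 3 * m)%N -> n%:R * (2 + nu) = 3 * m%:R :> R -> 0 < l <= 3 -> saddle nu l ->
  row_bound m n l e -> (0 < s)%N -> (4 * s <= m)%N ->
  e s <= 38 * Num.sqrt n%:R * (expR (6 + 3 * expR 3) * Num.sqrt (s%:R / m%:R)) ^+ s.
Proof.
move=> nm hnu /andP[l0 l3] sl rb s0 sm; set C := 38 * _.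
have C0 : 0 <= C by rewrite mulr_ge0 ?sqrtr_ge0.
have m0 : (0 < m)%N by lia.
have sm1 : (0 < s <= m)%N by lia.
have i1 : (4 * s = 2 * (s * 2))%N by lia.
have i2 : (4 * s = s + 3 * s)%N by lia.
have i3 : (3 * (m - s) <= 3 * m)%N by lia.
have M0 : 0 < m%:R :> R by rewrite ltr0n.
have S0 : 0 < s%:R :> R by rewrite ltr0n.
set p := Num.sqrt _.
have p2 : p ^+ 2 = s%:R / m%:R by rewrite sqr_sqrtr // divr_ge0.
have p0 : 0 < p by rewrite sqrtr_gt0 divr_gt0.
have ph : p <= 1 / 2.
  have h12 : 0 <= 1 / 2 :> R by lra.
  rewrite -(@ler_pXn2r _ 2) ?nnegrE ?(ltW p0) ?h12 // p2.
  rewrite ler_pdivrMr // (_ : (1 / 2) ^+ 2 * m%:R = m%:R / 4 :> R); last by field.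
  by rewrite ler_pdivlMr // -natrM ler_nat mulnC.
have p1 : 0 < 1 - p by lra.
have p01 : 0 < p < 1 by rewrite p0; lra.
have := rb s p sm1 p01; rewrite -/C; set r := (1 + _) / 2 => hb.
have r0 : 0 <= r := avg_ratio_ge0 _ l0.
have g0 := tail_exp_gt0 l0.
have hr : r <= expR (- (p * (2 + nu)) + 2 * expR 3 * p ^+ 2).
  apply: le_trans (_ : _ <= 1 + (- (p * (2 + nu)) + 2 * expR 3 * p ^+ 2)) (expR_ge1Dx _).
  have d0 : 0 <= 2 * p * l by rewrite mulr_ge0 ?(ltW l0) // mulr_ge0 // ltW.
  have := tail_exp_taylor l d0.
  have -> : l - 2 * p * l = (1 - p *+ 2) * l by rewrite mulr2n; ring.
  have -> : 2 * p * l * (expR l - 1) = 2 * p * (2 + nu) * tail_exp l.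
    by rewrite -[LHS]mulrA sl mulrA.
  have h1 : (2 * p * l) ^+ 2 / 2 * expR l <= 4 * expR 3 * p ^+ 2 * tail_exp l.
    have h2 := tail_exp_lower (ltW l0).
    have h3 : expR l <= expR 3 by rewrite ler_expR.
    apply: (@le_trans _ _ (4 * p ^+ 2 * (l ^+ 2 / 2 * expR l))).
      by rewrite le_eqVlt; apply/orP; left; apply/eqP; field.
    rewrite [leRHS](_ : _ = 4 * p ^+ 2 * (tail_exp l * expR 3)); last by ring.
    have q0 : 0 <= 4 * p ^+ 2 by rewrite mulr_ge0 // sqr_ge0.
    rewrite ler_wpM2l //; apply: ler_pM => //; rewrite ?expR_ge0.
    by rewrite divr_ge0 ?sqr_ge0.
  move=> h; have h4 : tail_exp ((1 - p *+ 2) * l) / tail_exp l <=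
     1 - 2 * p * (2 + nu) + 4 * expR 3 * p ^+ 2.
    by rewrite ler_pdivrMr //; lra.
  by rewrite /r; lra.
have p0h : 0 <= p <= 1 / 2 by rewrite (ltW p0).
have hq := inv1B_le_exp p0h.
set E := expR (p + 2 * p ^+ 2) in hq.
have E0 : 0 < E by exact: expR_gt0.
have hC := @bin_ge_pow R m s sm1.
have mE : m%:R / s%:R = p ^- 2 :> R by rewrite p2 invf_div.
rewrite mE in hC.
have e0 : e s <= 0 \/ 0 < e s by case: (leP (e s) 0); [left|right].
have [en|ep] := e0.
  by apply: le_trans en _; rewrite mulr_ge0 // exprn_ge0 // mulr_ge0 ?expR_ge0 // ltW.
have ps0 : 0 < p ^+ s by rewrite exprn_gt0.
(* E bounds 1 / (1-p), and p^(-4s) p^(3s) = p^(-s). *)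
have low : E ^- (3 * m) / p ^+ s <= 'C(m, s)%:R ^+ 2 * (p ^+ s * (1 - p) ^+ (m - s)) ^+ 3.
  have h1 : p ^- (4 * s) <= 'C(m, s)%:R ^+ 2.
    have -> : p ^- (4 * s) = ((p ^- 2) ^+ s) ^+ 2.
      by rewrite -exprM -[p ^- 2]exprVn -(exprM p^-1) -exprVn i1.
    by rewrite lerXn2r ?nnegrE ?exprn_ge0 ?invr_ge0 ?exprn_ge0 ?(ltW p0).
  have h2 : E ^- (3 * m) <= (1 - p) ^+ (3 * (m - s)).
    apply: (@le_trans _ _ ((1 - p) ^+ (3 * m))).
      rewrite -exprVn lerXn2r ?nnegrE ?invr_ge0 ?(ltW p1) ?(ltW E0) //.
      by rewrite -[leLHS]mul1r ler_pdivrMr.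
    by rewrite ler_wiXn2l ?(ltW p1) //; lra.
  have -> : 'C(m, s)%:R ^+ 2 * (p ^+ s * (1 - p) ^+ (m - s)) ^+ 3 =
    'C(m, s)%:R ^+ 2 * p ^+ (3 * s) * (1 - p) ^+ (3 * (m - s)) :> R.
    by rewrite exprMn -(exprM p) -(exprM (1 - p)) mulrA [(s * 3)%N]mulnC [((m - s) * 3)%N]mulnC.
  rewrite mulrC; apply: ler_pM => //; rewrite ?invr_ge0 ?exprn_ge0 ?(ltW E0) ?(ltW p0) //.
  have -> : (p ^+ s)^-1 = p ^- (4 * s) * p ^+ (3 * s).
    by rewrite i2 exprD invfM mulfVK // expf_neq0 // gt_eqF.
  by rewrite ler_wpM2r // exprn_ge0 // ltW.
have hb2 : E ^- (3 * m) / p ^+ s * e s <= C * r ^+ n.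
  by apply: le_trans hb; rewrite ler_wpM2r // ltW.
have hb3 : e s <= C * (E ^+ (3 * m) * r ^+ n) * p ^+ s.
  rewrite -ler_pdivrMr // -(ler_pM2l (_ : 0 < E ^- (3 * m))) ?invr_gt0 ?exprn_gt0 //.
  have -> : E ^- (3 * m) * (C * (E ^+ (3 * m) * r ^+ n)) = C * r ^+ n.
    by field; rewrite gt_eqF // exprn_gt0.
  by apply: le_trans hb2; rewrite le_eqVlt; apply/orP; left; apply/eqP; ring.
apply: le_trans hb3 _; rewrite [(_ * p) ^+ s]exprMn [leRHS]mulrA.
rewrite ler_wpM2r ?(ltW ps0) // ler_wpM2l //.
apply: (@le_trans _ _ (E ^+ (3 * m) * (expR (- (p * (2 + nu)) + 2 * expR 3 * p ^+ 2)) ^+ n)).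
  by rewrite ler_wpM2l ?exprn_ge0 ?(ltW E0) // lerXn2r ?nnegrE ?expR_ge0.
rewrite /E -!expRM_natl -expRD ler_expR.
have -> : (3 * m)%:R * (p + 2 * p ^+ 2) + n%:R * (- (p * (2 + nu)) + 2 * expR 3 * p ^+ 2) =
   (6 * m%:R + 2 * expR 3 * n%:R) * p ^+ 2 + p * (3 * m%:R - n%:R * (2 + nu)) :> R.
  by rewrite natrM; ring.
rewrite hnu subrr mulr0 addr0 p2 mulrA ler_pdivrMr //.
have nmR : 2 * n%:R <= 3 * m%:R :> R by rewrite -!natrM ler_nat.
have E3 := expR_ge0 (3 : R).
have : 2 * expR 3 * n%:R <= 3 * expR 3 * m%:R :> R by nra.
move=> h.
have : (6 * m%:R + 2 * expR 3 * n%:R) * s%:R <= (6 * m%:R + 3 * expR 3 * m%:R) * s%:R :> R.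
  by rewrite ler_wpM2r ?(ltW S0) // lerD2l.
by lra.
Qed.

(** Take p = 1-h.  Then 1-2p is close to -1, and g(-l) is smaller than g(l) by a
    definite amount; h is chosen so small that the factors p^(-3s) and
    (1-p)^(-3(m-s)) do not spoil this gain. *)
Lemma large_row_sets (R : realType) (m n : nat) (nu nu0 h l : R) (e : nat -> R) s :
  (0 < n)%N -> (m <= n)%N -> 0 < nu0 <= nu -> 0 < l <= 3 -> saddle nu l ->
  h = nu0 ^+ 3 / (6 * expR 3) / 18 -> 0 < h <= 1 / 2 ->
  row_bound m n l e -> (0 < s <= m)%N -> (m - s)%:R <= 2 * h ^+ 2 * n%:R ->
  e s <= 38 * Num.sqrt n%:R * expR (- (6 * h * n%:R)).
Proof.
move=> n0 mn /andP[nu00 nu0n] /andP[l0 l3] sl hE /andP[h0 h2] rb sm hs.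
have N0 : 0 < n%:R :> R by rewrite ltr0n.
have S0 : 0 <= (m - s)%:R :> R by exact: ler0n.
have mnR : m%:R <= n%:R :> R by rewrite ler_nat.
have smR : s%:R <= m%:R :> R by rewrite ler_nat; case/andP: sm.
have C1 : 1 <= 'C(m, s)%:R :> R by rewrite (ler_nat _ 1) bin_gt0; case/andP: sm.
set C := 38 * _; have C0 : 0 <= C by rewrite mulr_ge0 ?sqrtr_ge0.
have p01 : 0 < 1 - h < 1 by lra.
have := rb s (1 - h) sm p01; rewrite -/C; set r := (1 + _) / 2 => hb.
have r0 : 0 <= r := avg_ratio_ge0 _ l0.
have g0 := tail_exp_gt0 l0.
have hr : r <= expR (- (18 * h)).
  apply: le_trans (_ : _ <= 1 + - (18 * h)) (expR_ge1Dx _).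
  have ta : tail_exp ((1 - (1 - h) *+ 2) * l) <= tail_exp (- l).
    have -> : (1 - (1 - h) *+ 2) * l = - l + 2 * h * l by rewrite mulr2n; ring.
    set d := 2 * h * l; have d0 : 0 <= d by rewrite mulr_ge0 ?(ltW l0) // mulr_ge0 // ltW.
    have dl : d <= l by rewrite /d; nra.
    rewrite /tail_exp.
    have e1 : expR (- l + d) <= 1 by rewrite expR_le1; lra.
    have e2 : expR (- l) = expR (- l + d) * expR (- d) by rewrite -expRD; congr expR; ring.
    have := ler_wpM2l (expR_ge0 (- l + d)) (expR_ge1Dx (- d)); rewrite -e2.
    by have := ler_wpM2r d0 e1; lra.
  have tb := tail_expN_le (ltW l0).
  have l3g : l ^+ 3 / 3 >= 36 * h * tail_exp l.
    have gl : tail_exp l <= expR 3.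
      by rewrite /tail_exp (le_trans (_ : _ <= expR l)) ?ler_expR //; lra.
    have nl : nu0 <= l := le_trans nu0n (saddle_ge l0 sl).
    have n3 : nu0 ^+ 3 <= l ^+ 3 by rewrite lerXn2r ?nnegrE // ltW.
    have E3 := expR_gt0 (3 : R).
    have -> : 36 * h * tail_exp l = nu0 ^+ 3 / 3 * (tail_exp l / expR 3).
      by rewrite hE; field; rewrite gt_eqF.
    apply: (@le_trans _ _ (nu0 ^+ 3 / 3)); last by lra.
    rewrite ler_piMr ?divr_ge0 ?exprn_ge0 ?(ltW nu00) //.
    by rewrite ler_pdivrMr // mul1r.
  have : tail_exp ((1 - (1 - h) *+ 2) * l) / tail_exp l <= 1 - 36 * h.
    by rewrite ler_pdivrMr //; lra.
  by rewrite /r; lra.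
have h0h : 0 <= h <= 1 / 2 by rewrite (ltW h0).
have hq := inv1B_le_exp h0h.
have E0 : 0 < expR (h + 2 * h ^+ 2) by exact: expR_gt0.
have hv : 1 <= h * expR (1 / h).
  have := ler_wpM2l (ltW h0) (expR_ge1Dx (1 / h)).
  by rewrite mulrDr mulr1 mulrCA divff ?gt_eqF //; lra.
have [en|ep] := leP (e s) 0.
  by apply: le_trans en _; rewrite mulr_ge0 ?expR_ge0.
set A := expR (h + 2 * h ^+ 2) in hq E0; set B := expR (1 / h) in hv.
have B0 : 0 < B by exact: expR_gt0.
have h1 : 0 < 1 - h by lra.
have one (x y : R) k : 0 <= x -> 0 <= y -> 1 <= x * y -> 1 <= x ^+ k * y ^+ k.
  by move=> x0 y0 xy; rewrite -exprMn exprn_ege1.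
have low : 1 <= 'C(m, s)%:R ^+ 2 * ((1 - h) ^+ s * (1 - (1 - h)) ^+ (m - s)) ^+ 3 *
    (A ^+ s * B ^+ (m - s)) ^+ 3.
  have -> : 1 - (1 - h) = h by ring.
  have -> : 'C(m, s)%:R ^+ 2 * ((1 - h) ^+ s * h ^+ (m - s)) ^+ 3 * (A ^+ s * B ^+ (m - s)) ^+ 3 =
    'C(m, s)%:R ^+ 2 * (((1 - h) ^+ s * A ^+ s) * (h ^+ (m - s) * B ^+ (m - s))) ^+ 3 by ring.
  have a1 := one _ _ s (ltW h1) (ltW E0) hq.
  have b1 := one _ _ (m - s)%N (ltW h0) (ltW B0) hv.
  by apply: mulr_ege1; apply: exprn_ege1 => //; apply: mulr_ege1.
have AB0 : 0 <= (A ^+ s * B ^+ (m - s)) ^+ 3.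
  by rewrite exprn_ge0 // mulr_ge0 // exprn_ge0 // ltW.
have : e s <= C * r ^+ n * (A ^+ s * B ^+ (m - s)) ^+ 3.
  apply: le_trans (ler_wpM2r AB0 hb).
  by rewrite mulrAC -[leLHS]mul1r ler_wpM2r // ltW.
move=> hes; apply: le_trans hes _; rewrite -mulrA ler_wpM2l //.
apply: (@le_trans _ _ (expR (- (18 * h)) ^+ n * (A ^+ s * B ^+ (m - s)) ^+ 3)).
  by rewrite ler_wpM2r // lerXn2r ?nnegrE ?expR_ge0.
rewrite /A /B -!expRM_natl -!expRD -expRM_natl -expRD ler_expR.
have -> : (m - s)%:R * (1 / h) = (m - s)%:R / h :> R by rewrite div1r.
have q1 : (m - s)%:R / h <= 2 * h * n%:R :> R.
  by rewrite ler_pdivrMr // (le_trans hs) // le_eqVlt; apply/orP; left; apply/eqP; ring.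
have q2 : s%:R * (h + 2 * h ^+ 2) <= n%:R * (2 * h) :> R.
  apply: ler_pM => //; first by rewrite addr_ge0 ?(ltW h0) // mulr_ge0 // sqr_ge0.
    exact: le_trans smR mnR.
  by nra.
by lra.
Qed.

Lemma exists_cube_root (R : realType) (a : R) : 0 <= a -> exists2 x : R, 0 <= x & x ^+ 3 = a.
Proof.
move=> a0; exists (a `^ 3^-1); first exact: powR_ge0.
by rewrite -powR_mulrn ?powR_ge0 // -powRrM mulVf // powRr1.
Qed.

(** AM-GM for j numbers equal to u and n-j numbers equal to 1. *)
Lemma expr_le_weighted (R : realFieldType) (u : R) n j : 0 <= u -> (0 < n)%N -> (j <= n)%N ->
  u ^+ j <= (1 - j%:R / n%:R * (1 - u)) ^+ n.
Proof.
move=> u0 n0 jn.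
have := @leif_AGM R 'I_n 'I_n (fun i => if (i < j)%N then u else 1).
rewrite card_ord; move=> /(_ _)/leif_le h; have {}h := h _.
have P : \prod_(i in 'I_n) (if (i < j)%N then u else 1) = u ^+ j.
  rewrite -big_mkcondr /= prodr_const; congr (_ ^+ _).
  rewrite -sum1_card -(big_ord_widen_cond n xpredT (fun=> 1%N) jn) sum1_card card_ord //.
have S : \sum_(i in 'I_n) (if (i < j)%N then u else 1) = j%:R * u + (n - j)%:R.
  rewrite (bigID (fun i : 'I_n => (i < j)%N)) /=; congr (_ + _).
    rewrite (eq_bigr (fun=> u)) => [|i]; last by case: ifP; rewrite ?andbF.
    rewrite -(big_ord_widen_cond n xpredT (fun=> u) jn) sumr_const card_ord mulr_natl //.
  rewrite (eq_bigr (fun=> 1)) => [|i]; last by case: ifP; rewrite ?andbF.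
  have cj : #|(fun i : 'I_n => (i < j)%N)| = j.
    by rewrite -sum1_card -(big_ord_widen_cond n xpredT (fun=> 1%N) jn) sum1_card card_ord.
  have := cardC (fun i : 'I_n => (i < j)%N); rewrite cj card_ord => cn.
  rewrite sumr_const; congr (_ *+ _); rewrite -[in RHS]cn addKn.
  by apply: eq_card => i; rewrite !inE.
rewrite P S in h; apply: le_trans (h _) _.
  by move=> i _; case: ifP.
have N0 : n%:R != 0 :> R by rewrite pnatr_eq0 -lt0n.
rewrite natrB // le_eqVlt; apply/orP; left; apply/eqP; congr (_ ^+ _); by field.
Qed.

Lemma cube_root_product_ge (R : realFieldType) (eps x y : R) : 0 <= eps ->
  eps <= x -> eps <= y -> x ^+ 3 + y ^+ 3 = 1 -> eps <= 2 * (x * y).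
Proof.
move=> e0 ex ey xy.
have x0 := le_trans e0 ex; have y0 := le_trans e0 ey.
have h (u v : R) : 1 / 2 <= u -> eps <= v -> eps <= 2 * (u * v).
  move=> hu hv; rewrite [leLHS](_ : _ = 2 * (1 / 2 * eps)); last by field.
  by rewrite ler_wpM2l // ler_pM //; lra.
have [xh|xh] := leP (1 / 2) x; first exact: h.
have [yh|yh] := leP (1 / 2) y; first by rewrite [x * y]mulrC; exact: h.
have : x ^+ 3 <= (1 / 2) ^+ 3 by rewrite lerXn2r ?nnegrE // ltW // ltr_pdivlMr // mul0r.
have : y ^+ 3 <= (1 / 2) ^+ 3 by rewrite lerXn2r ?nnegrE // ltW // ltr_pdivlMr // mul0r.
by lra.
Qed.

(** With x^3 = s/m, y^3 = 1 - s/m and p = x^2 / (x^2+y^2), the weight of e s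
    becomes the square of the binomial probability of s, which is at least
    1 / (m+1)^2, times (1-b)^m, where 1-b = (x^2+y^2)^(-3).  The exponential
    gain comes from gap_product. *)
Lemma middle_row_sets (R : realType) (m n : nat) (nu nu1 eps l : R) (e : nat -> R) s :
  (0 < n)%N -> (m <= n)%N -> n%:R * (2 + nu) = 3 * m%:R :> R ->
  0 <= nu <= nu1 -> nu1 < 1 -> 0 < eps -> 0 < l <= 3 -> saddle nu l ->
  row_bound m n l e -> (0 < s < m)%N ->
  eps <= s%:R / m%:R <= 1 - eps ->
  e s <= 38 * Num.sqrt n%:R * m.+1%:R ^+ 2 *
    expR (- ((1 - nu1) * (eps / 2) ^+ 3 / 24 * n%:R)).
Proof.
move=> n0 mn hnu /andP[nu0 nuu] nu1l eps0 l03 sl rb sm /andP[ea ae].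
have sm1 : (0 < s <= m)%N by case/andP: sm => -> /ltnW.
have [l0 l3] := andP l03.
have N0 : 0 < n%:R :> R by rewrite ltr0n.
have M0 : 0 < m%:R :> R by rewrite ltr0n; case/andP: sm => a b; exact: leq_trans b.
have mode := @bin_mode R m s sm.
set a := s%:R / m%:R in ea ae mode.
have a0 : 0 <= a by lra.
have b0 : 0 <= 1 - a by lra.
have [x x0 xa] := exists_cube_root a0; have [y y0 ya] := exists_cube_root b0.
have xy1 : x ^+ 3 + y ^+ 3 = 1 by rewrite xa ya; ring.
have x1 : x <= 1.
  rewrite -(@ler_pXn2r _ 3) ?nnegrE // expr1n xa; lra.
have y1 : y <= 1.
  rewrite -(@ler_pXn2r _ 3) ?nnegrE // expr1n ya; lra.
have xe : eps <= x.
  rewrite (le_trans ea) // -xa !exprS expr0; have := mulr_ge0 x0 x0; nra.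
have ye : eps <= y.
  apply: le_trans (_ : _ <= 1 - a) _; first lra.
  rewrite -ya !exprS expr0; have := mulr_ge0 y0 y0; nra.
have xp : 0 < x by exact: lt_le_trans xe.
have yp : 0 < y by exact: lt_le_trans ye.
pose D := x ^+ 2 + y ^+ 2.
have D0 : 0 < D by rewrite addr_gt0 // exprn_gt0.
have D2 : D <= 2 by rewrite /D !expr2; nra.
have Dn : D != 0 by rewrite gt_eqF.
pose p := x ^+ 2 / D.
have pE : 1 - p = y ^+ 2 / D by rewrite /p /D; field.
have p01 : 0 < p < 1.
  by rewrite -[p < 1]subr_gt0 pE !divr_gt0 // exprn_gt0.
pose t := 1 - p *+ 2; pose w := 2 * x * y / D.
have tE : t = (y ^+ 2 - x ^+ 2) / D by rewrite /t /p mulr2n /D; field.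
have w0 : 0 <= w by rewrite divr_ge0 ?(ltW D0) // mulr_ge0 // mulr_ge0.
have tw : `|t| ^+ 2 + w ^+ 2 = 1.
  by rewrite real_normK ?num_real // tE /w /D; field.
have t1 : -1 <= t <= 1 by rewrite /t mulr2n; lra.
have at1 : 0 <= `|t| <= 1 by rewrite normr_ge0 ler_norml.
pose b := (3 * w ^+ 2 - w ^+ 3) / 4.
have bE : 1 - b = D ^- 3.
  have : D ^- 3 = (x ^+ 3 + y ^+ 3) ^+ 2 / D ^+ 3 by rewrite xy1 expr1n div1r.
  by move=> ->; rewrite /b /w /D; field.
have w1 : w <= 1 by have := sqr_ge0 (`|t|); nra.
have bp : 0 <= b by rewrite /b; nra.
have b1 : 0 < 1 - b by rewrite bE invr_gt0 exprn_gt0.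
have g0 := tail_exp_gt0 l0.
have nu01 : 0 <= nu <= 1 by lra.
set r1 := tail_exp (t * l) / tail_exp l.
have hr1 : r1 <= `|t| ^+ 2 * (1 - nu * (1 - `|t|) + 3 / 4 * (1 - `|t|) ^+ 2).
  by rewrite ler_pdivrMr //; exact: tail_exp_ratio_le.
pose q := 1 - (1 - nu) / 3 * b.
pose r := (1 + r1) / 2; pose eta := (1 - nu) * w ^+ 3 / 24.
have r0 : 0 <= r := avg_ratio_ge0 _ l0.
have qr : q * r <= (1 - b) * (1 - eta) := gap_product at1 w0 tw (erefl b) nu01 hr1.
have q0 : 0 < q.
  apply: lt_le_trans b1 _; rewrite /q lerD2l lerN2 ler_piMl //.
  by rewrite ler_pdivrMr //; lra.
have eta2 : 0 <= 1 - eta.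
  by rewrite -(pmulr_rge0 _ b1) (le_trans _ qr) // mulr_ge0 // ltW.
have nuE : (1 - nu) / 3 = (n - m)%:R / n%:R.
  by rewrite natrB // -[m%:R](@mulKf R 3) // -hnu; field; rewrite gt_eqF.
(* (1-b)^(n-m) <= q^n, as 1-q is the fraction (n-m)/n of b. *)
have agm := @expr_le_weighted R (1 - b) n (n - m) (ltW b1) n0 (leq_subr _ _).
rewrite -nuE (_ : 1 - (1 - b) = b) -/q in agm; last by ring.
have rn : r ^+ n <= (1 - b) ^+ m * (1 - eta) ^+ n.
  rewrite -(ler_pM2l (exprn_gt0 n q0)) -exprMn.
  apply: (@le_trans _ _ ((1 - b) ^+ n * (1 - eta) ^+ n)).
    by rewrite -exprMn lerXn2r ?nnegrE // mulr_ge0 // ltW.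
  rewrite mulrA ler_wpM2r ?exprn_ge0 //.
  by rewrite -{1}(subnK mn) exprD ler_wpM2r // exprn_ge0 // ltW.
have hb := rb s p sm1 p01; rewrite -/t -/r1 -/r in hb.
set C := 38 * _ in hb *; have C0 : 0 <= C by rewrite mulr_ge0 ?sqrtr_ge0.
have [en|ep] := leP (e s) 0.
  by apply: le_trans en _; rewrite mulr_ge0 ?expR_ge0 // mulr_ge0 // exprn_ge0.
set F := a ^+ s * (1 - a) ^+ (m - s) in mode.
have F0 : 0 <= F by rewrite mulr_ge0 ?exprn_ge0.
have pF : (p ^+ s * (1 - p) ^+ (m - s)) ^+ 3 = F ^+ 2 * (1 - b) ^+ m.
  have sm2 : (s <= m)%N by case/andP: sm1.
  have -> : (1 - b) ^+ m = (1 - b) ^+ s * (1 - b) ^+ (m - s) by rewrite -exprD subnKC.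
  have e1 : p ^+ 3 = a ^+ 2 * (1 - b) by rewrite bE /p -xa; field.
  have e2 : (1 - p) ^+ 3 = (1 - a) ^+ 2 * (1 - b) by rewrite bE pE -ya; field.
  rewrite exprMn (exprAC p) (exprAC (1 - p)) e1 e2.
  rewrite [(a ^+ 2 * _) ^+ _]exprMn [((1 - a) ^+ 2 * _) ^+ _]exprMn.
  rewrite [F ^+ 2]exprMn (exprAC a s) (exprAC (1 - a)).
  by rewrite mulrACA.
rewrite pF in hb.
have m1 : 1 <= m.+1%:R ^+ 2 * ('C(m, s)%:R * F) ^+ 2.
  by rewrite -exprMn exprn_ege1.
have Bm0 : 0 < (1 - b) ^+ m by rewrite exprn_gt0.
have fin : e s <= C * m.+1%:R ^+ 2 * (1 - eta) ^+ n.
  rewrite -(ler_pM2l Bm0).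
  apply: (@le_trans _ _ (m.+1%:R ^+ 2 * ('C(m, s)%:R ^+ 2 * (F ^+ 2 * (1 - b) ^+ m) * e s))).
    rewrite [leRHS](_ : _ =
      m.+1%:R ^+ 2 * ('C(m, s)%:R * F) ^+ 2 * ((1 - b) ^+ m * e s)); last by ring.
    by rewrite -[leLHS]mul1r ler_wpM2r // mulr_ge0 // ltW.
  rewrite [leRHS](_ : _ = m.+1%:R ^+ 2 * (C * ((1 - b) ^+ m * (1 - eta) ^+ n))); last by ring.
  by rewrite ler_wpM2l ?exprn_ge0 // (le_trans hb) // ler_wpM2l.
apply: le_trans fin _; rewrite ler_wpM2l ?mulr_ge0 ?exprn_ge0 //.
set X := (1 - nu1) * _ / 24; have -> : expR (- (X * n%:R)) = expR (- X) ^+ n.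
  by rewrite -expRM_natr mulNr.
rewrite lerXn2r ?nnegrE ?expR_ge0 //.
apply: le_trans (_ : _ <= 1 + - X) (expR_ge1Dx _).
have we : eps / 2 <= w.
  rewrite ler_pdivlMr // (le_trans (_ : _ <= eps)) //.
    by rewrite mulrAC ler_pdivrMr // ler_pM2l.
  by rewrite -mulrA cube_root_product_ge // ltW.
have w3e : (eps / 2) ^+ 3 <= w ^+ 3.
  by rewrite lerXn2r ?nnegrE // divr_ge0 // ltW.
have e3 : 0 <= (eps / 2) ^+ 3 by rewrite exprn_ge0 // divr_ge0 // ltW.
have nu1p : 0 <= 1 - nu1 by rewrite subr_ge0 ltW.
have nu1q : 1 - nu1 <= 1 - nu by rewrite lerD2l lerN2.
by rewrite lerD2l lerN2 /eta /X ler_wpM2r // ler_pM.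
Qed.

Lemma sum_half_powers (R : realFieldType) m : \sum_(1 <= s < m.+1) s%:R / 2 ^+ s <= 2 :> R.
Proof.
suff : \sum_(1 <= s < m.+1) s%:R / 2 ^+ s + m.+2%:R / 2 ^+ m = 2 :> R.
  move=> h; rewrite -[leRHS]h lerDl divr_ge0 // exprn_ge0 //.
elim: m => [|m IH]; first by rewrite big_nil expr0; field.
rewrite big_nat_recr //= -[RHS]IH -addrA; congr (_ + _).
have P : 2 ^+ m != 0 :> R by rewrite expf_neq0.
by rewrite exprS -[m.+3]addn2 -[m.+2]addn1 -[m.+1]addn1 !natrD; field.
Qed.

Lemma expRN_le_inv4 (R : realType) (c : R) n : 0 < c -> (0 < n)%N ->
  expR (- (c * n%:R)) <= 24 / c ^+ 4 / n%:R ^+ 4.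
Proof.
move=> c0 n0; have N0 : 0 < n%:R :> R by rewrite ltr0n.
have cn0 : 0 < c * n%:R by rewrite mulr_gt0.
have := expR_ge1Dxn 3 (ltW cn0); rewrite (_ : 4`! = 24)%N // exprMn => h.
have P : 0 < c ^+ 4 * n%:R ^+ 4 / 24 by rewrite divr_gt0 // mulr_gt0 // exprn_gt0.
rewrite expRN (_ : 24 / c ^+ 4 / n%:R ^+ 4 = (c ^+ 4 * n%:R ^+ 4 / 24)^-1); last first.
  by field; rewrite !gt_eqF.
by rewrite lef_pV2 ?posrE ?expR_gt0 //; lra.
Qed.

(** The range of s is cut at eps m and (1-eps) m.  For s >= 2 the small range
    gives O(s 2^(-s) / m) because one factor s/m can be kept aside; for s = 1
    the same estimate would only be of order sqrt n / sqrt m, hence the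
    hypothesis on e 1. *)
Lemma row_sum_bound (R : realType) (nu0 nu1 : R) : 0 < nu0 -> nu0 <= nu1 -> nu1 < 1 ->
  exists K : R, forall m n nu l (e : nat -> R),
  (0 < n)%N -> n%:R * (2 + nu) = 3 * m%:R -> nu0 <= nu <= nu1 ->
  0 < l <= 3 -> saddle nu l -> row_bound m n l e -> e 1%N = 0 ->
  \sum_(1 <= s < m.+1) e s <= K / Num.sqrt n%:R.
Proof.
move=> nu00 nu01 nu1l.
(* The cut eps satisfies eps <= h^2 for the large range and
   K1 sqrt eps <= 1/2 for the small one. *)
pose h : R := nu0 ^+ 3 / (6 * expR 3) / 18.
have E3 : 1 <= expR 3 :> R by rewrite (le_trans _ (expR_ge1Dx 3)) //; lra.
have n31 : nu0 ^+ 3 <= 1 by rewrite exprn_ile1 ?ltW //; lra.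
have h0 : 0 < h by rewrite !divr_gt0 ?exprn_gt0 // mulr_gt0 //; lra.
have h2 : h <= 1 / 2.
  rewrite /h ler_pdivrMr // ler_pdivrMr; [nra|lra].
pose K1 : R := expR (6 + 3 * expR 3).
have K10 : 0 < K1 := expR_gt0 _.
have K11 : 1 <= K1 by rewrite (le_trans _ (expR_ge1Dx _)) //; lra.
have K2 : 1 <= K1 ^+ 2 by rewrite exprn_ege1.
pose eps := Num.min (h ^+ 2) (1 / (4 * K1 ^+ 2)).
have eps0 : 0 < eps.
  by rewrite lt_min exprn_gt0 //= divr_gt0 // mulr_gt0 // exprn_gt0.
have epsh : eps <= h ^+ 2 by rewrite ge_min lexx.
have epsK : eps <= 1 / (4 * K1 ^+ 2) by rewrite ge_min lexx orbT.
have epsK' : 4 * K1 ^+ 2 * eps <= 1.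
  by rewrite mulrC -ler_pdivlMr //; lra.
have eps4 : 4 * eps <= 1 by nra.
pose eta := (1 - nu1) * (eps / 2) ^+ 3 / 24.
have eta0 : 0 < eta by rewrite divr_gt0 // mulr_gt0 ?exprn_gt0 ?divr_gt0 //; lra.
have h60 : 0 < 6 * h by lra.
exists (38 * (12 * K1 ^+ 2 + 96 / eta ^+ 4 + 24 / (6 * h) ^+ 4)).
move=> m n nu l e n0 hnu /andP[nu0n nun1] l03 sl rb e1.
have N0 : 0 < n%:R :> R by rewrite ltr0n.
have mnR : m%:R <= n%:R :> R by nra.
have nmR : 2 * n%:R <= 3 * m%:R :> R by nra.
have mn : (m <= n)%N by rewrite -(ler_nat R).
have nm : (2 * n <= 3 * m)%N by rewrite -(ler_nat R) !natrM.
have M0 : 0 < m%:R :> R by lra.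
have m0 : (0 < m)%N by rewrite -(ltr_nat R).
set S := Num.sqrt _; have S0 : 0 < S by rewrite sqrtr_gt0.
pose bnd s := 38 * S * (4 * K1 ^+ 2 / m%:R * (s%:R / 2 ^+ s) +
   m.+1%:R ^+ 2 * expR (- (eta * n%:R)) + expR (- (6 * h * n%:R))).
have C0 : 0 <= 38 * S by rewrite mulr_ge0 // ltW.
have t1 s : 0 <= 4 * K1 ^+ 2 / m%:R * (s%:R / 2 ^+ s).
  by rewrite !mulr_ge0 ?invr_ge0 ?exprn_ge0 ?(ltW K10) // ltW.
have t2 : 0 <= m.+1%:R ^+ 2 * expR (- (eta * n%:R)) by rewrite mulr_ge0 ?exprn_ge0 ?expR_ge0.
have t3 : 0 <= expR (- (6 * h * n%:R)) by exact: expR_ge0.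
have term s : (0 < s <= m)%N -> e s <= bnd s.
  move=> sm; have [s0 sm'] := andP sm.
  have [s1|s2] := leqP s 1.
    have -> : s = 1%N by apply/eqP; rewrite eqn_leq s1 s0.
    by rewrite e1 mulr_ge0 // !addr_ge0.
  have SR : 0 < s%:R :> R by rewrite ltr0n.
  have [small|big] := leP (s%:R / m%:R) eps.
    have sm4 : (4 * s <= m)%N.
      rewrite -(ler_nat R) natrM; move: small; rewrite ler_pdivrMr //.
      by have := ler_wpM2r (ltW M0) eps4; lra.
    have := small_row_sets nm hnu l03 sl rb s0 sm4.
    rewrite -/K1 -/S => hs; apply: le_trans hs _; rewrite ler_wpM2l // -addrA.
    apply: ler_wpDr; first by rewrite addr_ge0.
    set g := K1 * _; have g0 : 0 <= g by rewrite mulr_ge0 ?sqrtr_ge0 // ltW.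
    have g2 : g ^+ 2 = K1 ^+ 2 * (s%:R / m%:R).
      by rewrite exprMn sqr_sqrtr // divr_ge0.
    have gh : g <= 1 / 2.
      have h12 : 0 <= 1 / 2 :> R by lra.
      rewrite -(@ler_pXn2r _ 2) ?nnegrE ?h12 // g2.
      by have := ler_wpM2l (sqr_ge0 K1) small; lra.
    have e2 : s = (2 + (s - 2))%N by rewrite subnKC.
    rewrite {1}e2 exprD g2 [in X in _ <= X]e2 exprD.
    have gs : g ^+ (s - 2) <= (1 / 2) ^+ (s - 2) by rewrite lerXn2r ?nnegrE //; lra.
    have P : 2 ^+ (s - 2) != 0 :> R by rewrite expf_neq0.
    rewrite -e2 [leRHS](_ : _ = K1 ^+ 2 * (s%:R / m%:R) * (1 / 2) ^+ (s - 2)); last first.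
      rewrite div1r exprVn; move: P; move: (2 ^+ (s - 2)) => Q P.
      by field; rewrite ?P ?gt_eqF.
    by rewrite ler_wpM2l // -g2 sqr_ge0.
  have [large|mid] := leP (1 - eps) (s%:R / m%:R).
    have hms : (m - s)%:R <= 2 * h ^+ 2 * n%:R :> R.
      rewrite natrB //; move: large; rewrite ler_pdivlMr // => large.
      have := ler_pM (ltW eps0) (ltW M0) epsh mnR.
      by have := mulr_ge0 (sqr_ge0 h) (ltW N0); lra.
    have nu0nu : 0 < nu0 <= nu by rewrite nu00.
    have h0h2 : 0 < h <= 1 / 2 by rewrite h0.
    have := large_row_sets n0 mn nu0nu l03 sl erefl h0h2 rb sm hms.
    move=> hs; apply: le_trans hs _; rewrite -/S /bnd ler_wpM2l //.
    by rewrite lerDr addr_ge0.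
  have smm : (0 < s < m)%N.
    rewrite s0 /= -(ltr_nat R); move: (mid); rewrite ltr_pdivrMr //.
    by have := mulr_gt0 eps0 M0; lra.
  have nuu : 0 <= nu <= nu1 by rewrite nun1 andbT; lra.
  have em : eps <= s%:R / m%:R <= 1 - eps by rewrite !ltW.
  have := middle_row_sets n0 mn hnu nuu nu1l eps0 l03 sl rb smm em.
  move=> hs; apply: le_trans hs _; rewrite -/S -/eta /bnd -mulrA ler_wpM2l //.
  by rewrite -addrA addrCA lerDl addr_ge0.
apply: (@le_trans _ _ (\sum_(1 <= s < m.+1) bnd s)).
  by rewrite !big_nat; apply: ler_sum => s hs; apply: term.
rewrite -big_distrr big_split big_split /= -big_distrr /= !sumr_const_nat subn1 /=.
have b1 : 4 * K1 ^+ 2 / m%:R * \sum_(1 <= s < m.+1) s%:R / 2 ^+ s <= 12 * K1 ^+ 2 / n%:R.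
  apply: (@le_trans _ _ (4 * K1 ^+ 2 / m%:R * 2)).
    by rewrite ler_wpM2l ?sum_half_powers // divr_ge0 ?ltW // mulr_gt0 // exprn_gt0.
  rewrite ler_pdivlMr // [leLHS](_ : _ = 8 * K1 ^+ 2 * n%:R / m%:R); last by ring.
  by rewrite ler_pdivrMr //; have := ler_wpM2l (sqr_ge0 K1) nmR; lra.
have e4 := expRN_le_inv4 eta0 n0; have e5 := expRN_le_inv4 h60 n0.
have b2 : (m.+1%:R ^+ 2 * expR (- (eta * n%:R))) *+ m <= 96 / eta ^+ 4 / n%:R.
  have -> : 96 / eta ^+ 4 / n%:R = 4 * n%:R ^+ 3 * (24 / eta ^+ 4 / n%:R ^+ 4).
    by field; rewrite !gt_eqF // exprn_gt0.
  rewrite -[leLHS]mulr_natl mulrA ler_pM ?expR_ge0 ?mulr_ge0 ?exprn_ge0 //.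
  have m2 : m.+1%:R <= 2 * n%:R :> R by rewrite -natrM ler_nat mul2n -addnn -addn1 leq_add.
  have m2s : m.+1%:R ^+ 2 <= (2 * n%:R) ^+ 2 :> R by rewrite lerXn2r ?nnegrE // mulr_ge0.
  have : m%:R * m.+1%:R ^+ 2 <= n%:R * (2 * n%:R) ^+ 2 :> R by rewrite ler_pM // exprn_ge0.
  by rewrite !exprS expr0; lra.
have b3 : expR (- (6 * h * n%:R)) *+ m <= 24 / (6 * h) ^+ 4 / n%:R.
  have -> : 24 / (6 * h) ^+ 4 / n%:R = n%:R ^+ 3 * (24 / (6 * h) ^+ 4 / n%:R ^+ 4).
    by field; rewrite !gt_eqF // exprn_gt0.
  rewrite -[leLHS]mulr_natl ler_pM ?expR_ge0 //.
  apply: le_trans mnR _; have n1 : 1 <= n%:R :> R by rewrite ler1n.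
  by rewrite -[leLHS]expr1 ler_weXn2l.
apply: (@le_trans _ _ (38 * S *
  (12 * K1 ^+ 2 / n%:R + 96 / eta ^+ 4 / n%:R + 24 / (6 * h) ^+ 4 / n%:R))).
  by rewrite ler_wpM2l // !lerD.
have nS : n%:R = S ^+ 2 by rewrite sqr_sqrtr.
rewrite nS le_eqVlt; apply/orP; left; apply/eqP.
by field; rewrite !gt_eqF // exprn_gt0.
Qed.

(** * Linear algebra mod 2 and the probability of solvability *)

Definition row_slots (m : nat) (S : {set 'I_m}) : {set 'I_m * 'I_3} :=
  [set t | t.1 \in S].

Lemma card_row_slots (m : nat) (S : {set 'I_m}) : #|row_slots S| = (3 * #|S|)%N.
Proof.
have -> : row_slots S = finset.setX S [set: 'I_3].
  by apply/setP => -[i k]; rewrite !inE andbT.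
by rewrite cardsX cardsT card_ord mulnC.
Qed.

Lemma card_fiber_rows (m n : nat) (f : slot_assignment m n) (S : {set 'I_m}) j :
  #|fiber f j :&: row_slots S| = (\sum_(i in S) xor_matrix f i j)%N.
Proof.
under eq_bigr do rewrite mxE -sum1dep_card.
rewrite pair_big_dep /= -sum1_card; apply: eq_bigl => -[i k].
by rewrite !inE andbC.
Qed.

Lemma two_coreE (m n : nat) (f : slot_assignment m n) :
  two_core (xor_matrix f) = (f \in core_fun _ _).
Proof.
rewrite inE; apply: eq_forallb => j; congr (_ < _)%N.
have := card_fiber_rows f [set: 'I_m] j.
have -> : row_slots [set: 'I_m] = [set: 'I_m * 'I_3] by apply/setP => t; rewrite !inE.
by rewrite finset.setIT => ->; apply: eq_bigl => i; rewrite inE.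
Qed.

Lemma natrF2_eq0 k : (k%:R == 0 :> 'F_2) = ~~ odd k.
Proof. by rewrite -(dvdn_pcharf (pchar_Fp (isT : prime 2))) dvdn2. Qed.

Lemma F2_neq0 (x : 'F_2) : x != 0 -> x = 1.
Proof. by case: x => [[|[|k]]] // h _; apply: val_inj. Qed.

(** Over F_2 a row vector v with v Gamma = 0 is the indicator of a set of rows
    that meets every variable evenly.  If only the empty set does so, Gamma has
    a right inverse, which produces z. *)
Lemma independent_rows_solvable (m n : nat) (f : slot_assignment m n) b :
  (forall S, even_on f (row_slots S) -> S = finset.set0) ->
  xor_solvable (xor_matrix f) b.
Proof.
move=> ind; pose G : 'M['F_2]_(m, n) := \matrix_(i, j) (xor_matrix f i j)%:R.
have free : row_free G.
  rewrite -kermx_eq0; apply/rowV0P => v /sub_kermxP vG.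
  have /ind S0 : even_on f (row_slots [set i | v 0 i != 0]).
    apply/forallP => j; rewrite card_fiber_rows -natrF2_eq0.
    have /matrixP /(_ 0 j) := vG; rewrite !mxE => h; rewrite -[X in _ == X]h.
    rewrite natr_sum big_mkcond; apply/eqP/eq_bigr => i _.
    rewrite inE [G _ _]mxE; case: eqP => [->|/eqP /F2_neq0 ->] /=.
      by rewrite mul0r.
    by rewrite mul1r.
  apply/rowP => i; rewrite mxE; apply/eqP; rewrite -[_ == _]negbK.
  by have /setP /(_ i) := S0; rewrite !inE => ->.
have /row_freeP[B GB] := free.
pose c : 'cV['F_2]_m := \col_i (b i)%:R.
have sol : G *m (B *m c) = c by rewrite mulmxA GB mul1mx.
apply/existsP; exists [ffun j => (B *m c) j 0 != 0]; apply/forallP => i.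
have /matrixP /(_ i 0) := sol; rewrite [in RHS]mxE mxE => h.
apply/eqP; rewrite -!(val_Fp_nat (isT : prime 2)); congr val.
rewrite -h natr_sum; apply: eq_bigr => j _; rewrite natrM ffunE; congr (_ * _).
  by rewrite [G _ _]mxE.
by case: eqP => [->|/eqP/F2_neq0 ->].
Qed.

Lemma card_solvable_le (m n : nat) (G : 'M[nat]_(m, n)) :
  (#|[set b | xor_solvable G b]| <= 2 ^ n)%N.
Proof.
have -> : (2 ^ n)%N = #|[set: {ffun 'I_n -> bool}]|.
  by rewrite cardsT card_ffun card_bool card_ord.
apply: leq_trans (leq_imset_card (fun z : {ffun 'I_n -> bool} =>
  [ffun i => odd (\sum_j G i j * z j)%N]) _).
apply/subset_leq_card/fintype.subsetP => b; rewrite inE => /existsP[z /forallP bz].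
apply/imsetP; exists z; rewrite ?inE //; apply/ffunP => i; rewrite ffunE.
by have := bz i; rewrite !modn2 oddb; case: (odd _); case: (b i).
Qed.

Lemma card_two_core (m n : nat) :
  #|two_core_systems m n| = (#|core_fun ('I_m * 'I_3)%type 'I_n| * 2 ^ m)%N.
Proof.
have -> : two_core_systems m n = finset.setX
    (core_fun ('I_m * 'I_3)%type 'I_n) [set: {ffun 'I_m -> bool}].
  by apply/setP => -[f b]; rewrite [LHS]inE [RHS]inE /= two_coreE finset.in_setT andbT.
by rewrite cardsX cardsT card_ffun card_bool card_ord.
Qed.

Lemma card_solvable (m n : nat) :
  #|solvable_systems m n| =
  (\sum_(f in core_fun ('I_m * 'I_3)%type 'I_n) #|[set b | xor_solvable (xor_matrix f) b]|)%N.
Proof.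
under eq_bigr do rewrite -sum1dep_card.
rewrite pair_big_dep -sum1_card; apply: eq_bigl => -[f b] /=.
by rewrite [LHS]inE [in LHS]inE two_coreE.
Qed.

Lemma solvable_prob_ge0 (R : realType) m n : 0 <= solvable_prob R m n.
Proof. by rewrite divr_ge0. Qed.

Lemma solvable_prob_le1 (R : realType) m n : solvable_prob R m n <= 1.
Proof.
have h : (#|solvable_systems m n| <= #|two_core_systems m n|)%N.
  by apply/subset_leq_card/fintype.subsetP => s; rewrite inE => /andP[].
rewrite /solvable_prob; have [->|n0] := posnP #|two_core_systems m n|.
  by rewrite invr0 mulr0.
by rewrite ler_pdivrMr ?ltr0n // mul1r ler_nat.
Qed.

Lemma solvable_prob_le_pow (R : realType) m n :
  solvable_prob R m n <= 2 ^+ n / 2 ^+ m.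
Proof.
rewrite /solvable_prob card_two_core card_solvable.
set N := #|core_fun _ _|; have [N0|N0] := posnP N.
  by rewrite N0 mul0n invr0 mulr0 divr_ge0 ?exprn_ge0.
have P0 : 0 < 2 ^+ m :> R by rewrite exprn_gt0.
rewrite natrM natrX ler_pdivrMr ?mulr_gt0 ?ltr0n //.
have -> : 2 ^+ n / 2 ^+ m * (N%:R * 2 ^+ m) = N%:R * 2 ^+ n :> R.
  by field; rewrite gt_eqF.
rewrite -natrX -natrM ler_nat -sum_nat_const; apply: leq_sum => f _.
exact: card_solvable_le.
Qed.

Lemma bin_mul_le (a b i j : nat) : ('C(a, i) * 'C(b, j) <= 'C(a + b, i + j))%N.
Proof.
rewrite -binomial.Vandermonde; have ij : (i < (i + j).+1)%N by rewrite ltnS leq_addr.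
by rewrite (bigD1 (Ordinal ij)) //= addKn leq_addr.
Qed.

Lemma bin_cube_le (m s : nat) : ('C(m, s) ^ 3 <= 'C(3 * m, 3 * s))%N.
Proof.
have -> : (3 * m = m + (m + m))%N by lia.
have -> : (3 * s = s + (s + s))%N by lia.
apply: leq_trans (bin_mul_le _ _ _ _).
by rewrite expnS leq_mul2l expnS expn1 bin_mul_le orbT.
Qed.

(** A set of slots is the disjoint union of its intersections with the
    fibers. *)
Lemma even_on_card (T I : finType) (f : {ffun T -> I}) (s : {set T}) :
  even_on f s -> ~~ odd #|s|.
Proof.
move=> /forallP ev.
have -> : #|s| = (\sum_v #|fiber f v :&: s|)%N.
  rewrite -sum1_card (partition_big f xpredT) //=; apply: eq_bigr => v _.
  by rewrite -sum1_card; apply: eq_bigl => t; rewrite !inE andbC.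
by elim/big_ind: _ => // a b; rewrite oddD; case: odd; case: odd.
Qed.

Definition initial_rows (m s : nat) : {set 'I_m} := [set i : 'I_m | (i < s)%N].

Lemma card_initial_rows (m s : nat) : (s <= m)%N -> #|initial_rows m s| = s.
Proof.
move=> sm; rewrite -sum1dep_card.
by rewrite -(big_ord_widen_cond m xpredT (fun=> 1%N) sm) sum1_card card_ord.
Qed.

Definition dependent_count (m n s : nat) : nat :=
  #|[set f in core_fun ('I_m * 'I_3)%type 'I_n | even_on f (row_slots (initial_rows m s))]|.

(** Union bound over the nonempty sets of rows, grouped by size; by
    exchangeability one representative of each size suffices. *)
Lemma solvable_prob_ge (R : realType) m n : (0 < #|core_fun ('I_m * 'I_3)%type 'I_n|)%N ->
  1 - \sum_(1 <= s < m.+1) 'C(m, s)%:R * (dependent_count m n s)%:R /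
      #|core_fun ('I_m * 'I_3)%type 'I_n|%:R <= solvable_prob R m n.
Proof.
set core := core_fun _ _; set N := #|core| => N0.
pose bad := [set f in core |
  [exists S : {set 'I_m}, (S != finset.set0) && even_on f (row_slots S)]].
have badB : (#|bad| <= \sum_(1 <= s < m.+1) 'C(m, s) * dependent_count m n s)%N.
  pose Z (S : {set 'I_m}) := #|[set f in core | even_on f (row_slots S)]|.
  have ZE S : Z S = dependent_count m n #|S|.
    apply: card_even_on_eq; rewrite !card_row_slots card_initial_rows //.
    by rewrite -[X in (_ <= X)%N]card_ord max_card.
  apply: (@leq_trans (\sum_(S : {set 'I_m} | S != finset.set0) Z S)%N).
    rewrite -sum1_card; under [leqRHS]eq_bigr do rewrite /Z -sum1_card.
    rewrite (exchange_big_dep (mem core)) /=; last by move=> S f _; rewrite inE => /andP[].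
    rewrite [leqLHS](_ : _ = \sum_(f in core) (f \in bad))%N; last first.
      rewrite big_mkcond [RHS]big_mkcond; apply: eq_bigr => f _.
      by rewrite inE; case: (f \in core); case: [exists _, _].
    apply: leq_sum => f fc; case: (boolP (f \in bad)) => // /=.
    rewrite inE fc /= => /existsP[S /andP[S0 eS]].
    have PS : (S != finset.set0) && (f \in [set g in core | even_on g (row_slots S)]).
      by rewrite S0 inE fc eS.
    by rewrite (bigD1 S).
  rewrite (partition_big (fun S : {set 'I_m} => inord #|S| : 'I_m.+1) xpredT) //=.
  rewrite [leqRHS](_ : _ = \sum_(s < m.+1)
      if (0 < s)%N then ('C(m, s) * dependent_count m n s)%N else 0%N)%N; last first.
    by rewrite big_ord_recl /= add0n big_add1 /= big_mkord; apply: eq_bigr.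
  apply: leq_sum => s _.
  have cS (S : {set 'I_m}) : (inord #|S| == s) = (#|S| == s).
    by rewrite -val_eqE /= inordK // ltnS -[X in (_ <= X)%N]card_ord max_card.
  case: ifPn => s0; last first.
    rewrite big1 // => S /andP[S0]; rewrite cS => /eqP Ss.
    by move: s0; rewrite -Ss lt0n cards_eq0 S0.
  rewrite -[X in 'C(X, _)](card_ord m) -card_draws -sum_nat_const.
  rewrite big_mkcond [leqRHS]big_mkcond; apply: leq_sum => S _.
  rewrite inE cS; case: (boolP (#|S| == s)) => [/eqP Ss|_]; last by rewrite andbF.
  by case: ifP => // _; rewrite ZE Ss.
have good f : f \in core -> f \notin bad -> [set b | xor_solvable (xor_matrix f) b] = [set: _].
  move=> fc; rewrite inE fc /= => /existsPn nb; apply/setP => b; rewrite !inE.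
  apply: independent_rows_solvable => S eS; apply/eqP.
  by have := nb S; rewrite eS andbT negbK.
have P2 : 0 < 2 ^+ m :> R by rewrite exprn_gt0.
have NR : 0 < N%:R :> R by rewrite ltr0n.
rewrite /solvable_prob card_two_core -/core -/N natrM natrX ler_pdivlMr ?mulr_gt0 //.
have : (N * 2 ^ m <= #|solvable_systems m n| + #|bad| * 2 ^ m)%N.
  rewrite card_solvable -!sum_nat_const.
  have -> : (\sum_(f in bad) 2 ^ m = \sum_(f in core) if f \in bad then 2 ^ m else 0)%N.
    rewrite -big_mkcondr /=; apply: eq_bigl => f; rewrite inE.
    by case: (f \in core).
  rewrite -big_split /=; apply: leq_sum => f fc.
  case: ifPn => fb; first by rewrite leq_addl.
  by rewrite good // addn0 cardsT card_ffun card_bool card_ord.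
rewrite -(ler_nat R) natrD !natrM natrX => h.
have : #|bad|%:R <= \sum_(1 <= s < m.+1) ('C(m, s)%:R * (dependent_count m n s)%:R) :> R.
  apply: le_trans (_ : _ <= (\sum_(1 <= s < m.+1) 'C(m, s) * dependent_count m n s)%N%:R) _.
    by rewrite ler_nat.
  by rewrite natr_sum le_eqVlt; apply/orP; left; apply/eqP/eq_bigr => s _; rewrite natrM.
move=> /(ler_wpM2r (ltW P2)) h2.
rewrite -big_distrl /= mulrBl mul1r.
set X := \sum_(1 <= s < m.+1) _ in h2 *.
have -> : X / N%:R * (N%:R * 2 ^+ m) = X * 2 ^+ m by field; rewrite gt_eqF.
by lra.
Qed.

(** * The threshold *)

(** A row has three slots, an odd number. *)
Lemma dependent_count1 (m n : nat) : (0 < m)%N -> dependent_count m n 1 = 0%N.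
Proof.
move=> m0; apply/eqP; rewrite cards_eq0; apply/eqP/setP => f; rewrite !inE.
apply/negbTE; rewrite negb_and orbC; apply/orP; left; apply/negP => /even_on_card.
by rewrite card_row_slots card_initial_rows.
Qed.

(** A set of s rows is a set of 3s slots, and 'C(m,s)^3 is at most
    'C(3m,3s). *)
Lemma dependent_row_bound (R : realType) (m n : nat) (nu l : R) :
  (0 < n)%N -> (2 * n < 3 * m <= 3 * n)%N -> n%:R * (2 + nu) = 3 * m%:R ->
  0 < l -> saddle nu l ->
  row_bound m n l (fun s => 'C(m, s)%:R * (dependent_count m n s)%:R /
      #|core_fun ('I_m * 'I_3)%type 'I_n|%:R).
Proof.
move=> n0 nm hnu l0 sl s p /andP[s0 sm] p01; have [p0 p1] := andP p01.
have q0 : 0 < 1 - p by rewrite subr_gt0.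
set N := #|core_fun _ _|.
have N0 : 0 < N%:R :> R.
  rewrite /N (@card_core_fun R _ _ (3 * m)) ?card_prod ?card_ord 1?mulnC //.
  rewrite pmulrn_lgt0 ?fact_gt0 // mulnC coef_core_poly_gt0 // leqnn andbT.
  by case/andP: nm => /ltnW.
have := @even_core_bound R _ 'I_n n (3 * m) l (2 + nu) p (row_slots (initial_rows m s)).
rewrite card_prod !card_ord card_row_slots card_initial_rows // mulnC.
move=> /(_ erefl erefl n0 nm l0 sl); rewrite natrM => /(_ hnu p01).
rewrite -/N -/(dependent_count m n s); set C := 38 * _; set rn := (_ / 2) ^+ n => h.
set d := (dependent_count m n s)%:R in h *.
rewrite [leLHS]mulrA ler_pdivrMr //; apply: le_trans h.
rewrite -mulnBr; set F := p ^+ s * (1 - p) ^+ (m - s).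
have -> : p ^+ (3 * s) * (1 - p) ^+ (3 * (m - s)) = F ^+ 3.
  by rewrite exprMn -(exprM p) -(exprM (1 - p)) [(3 * s)%N]mulnC [(3 * (m - s))%N]mulnC.
have F0 : 0 <= F ^+ 3 by rewrite exprn_ge0 // mulr_ge0 ?exprn_ge0 ?(ltW p0) ?(ltW q0).
have -> : 'C(m, s)%:R ^+ 2 * F ^+ 3 * ('C(m, s)%:R * d) = ('C(m, s) ^ 3)%:R * F ^+ 3 * d.
  by rewrite natrX; ring.
by rewrite !ler_wpM2r ?ler0n // ler_nat bin_cube_le.
Qed.

Lemma solvable_prob_lower (R : realType) (nu0 nu1 : R) :
  0 < nu0 -> nu0 <= nu1 -> nu1 < 1 ->
  exists K : R, forall m n nu, (0 < n)%N -> n%:R * (2 + nu) = 3 * m%:R ->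
  nu0 <= nu <= nu1 -> 1 - K / Num.sqrt n%:R <= solvable_prob R m n.
Proof.
move=> n0 n01 n1; have [K hK] := row_sum_bound n0 n01 n1; exists K => m n nu np hnu hnn.
have [na nb] := andP hnn.
have nu01 : 0 < nu < 1 by lra.
have [l /andP[l1 l2] sl] := exists_saddle nu01.
have l0 : 0 < l by lra.
have l03 : 0 < l <= 3 by rewrite l0; lra.
have N0 : 0 < n%:R :> R by rewrite ltr0n.
have nm : (2 * n < 3 * m <= 3 * n)%N.
  by rewrite -(ltr_nat R) -(ler_nat R) !natrM; apply/andP; split; nra.
have m0 : (0 < m)%N by case: (posnP m) nm => // ->; rewrite muln0 ltn0.
have rb := dependent_row_bound np nm hnu l0 sl.
have := hK m n nu l _ np hnu hnn l03 sl rb; rewrite dependent_count1 // mulr0 mul0r => /(_ erefl) h.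
apply: le_trans (solvable_prob_ge R _); first by rewrite lerD2l lerN2.
rewrite -(ltr_nat R) (@card_core_fun R _ _ (3 * m)) ?card_prod ?card_ord 1?mulnC //.
rewrite pmulrn_lgt0 ?fact_gt0 // mulnC coef_core_poly_gt0 // leqnn andbT.
by case/andP: nm => /ltnW.
Qed.

Local Open Scope classical_set_scope.

Lemma ratio_lim_below (R : realType) (c : R) : 2 / 3 < c < 1 ->
  ratio_lim (@solvable_prob R) c 1.
Proof.
move=> /andP[c0 c1] m n mnk mnc.
pose nu0 : R := (3 * c - 2) / 2; pose nu1 : R := (3 * c - 1) / 2.
have h0 : 0 < nu0 by rewrite /nu0; lra.
have h01 : nu0 <= nu1 by rewrite /nu0 /nu1; lra.
have h1 : nu1 < 1 by rewrite /nu1; lra.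
have [K hK] := solvable_prob_lower h0 h01 h1.
have ncv : ((n k)%:R : R) @[k --> \oo] --> +oo.
  apply/cvgryPge => A; near=> k.
  apply: (@le_trans _ _ k%:R); last by rewrite ler_nat; case: (mnk k).
  by near: k; exact: nbhs_infty_ger.
have lower : 1 - K / Num.sqrt (n k)%:R @[k --> \oo] --> (1 : R).
  rewrite -[X in _ --> X]subr0; apply: cvgB; first exact: cvg_cst.
  rewrite -(mulr0 K); apply: cvgMr.
  apply/cvgr0Pnorm_lt => e e0; near=> k.
  have nk : e ^- 2 < (n k)%:R.
    by near: k; move/cvgryPgt : ncv; apply.
  have nk0 : 0 < (n k)%:R :> R by apply: lt_trans nk; rewrite invr_gt0 exprn_gt0.
  rewrite ger0_norm ?invr_ge0 ?sqrtr_ge0 // invf_plt ?posrE ?sqrtr_gt0 //.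
  rewrite -(@ltr_pXn2r _ 2) ?nnegrE ?invr_ge0 ?sqrtr_ge0 ?(ltW e0) //.
  by rewrite sqr_sqrtr ?(ltW nk0) // exprVn.
apply: (squeeze_cvgr _ lower (cvg_cst (1 : R))).
near=> k; rewrite solvable_prob_le1 andbT.
have nk : (0 < n k)%N.
  by apply: leq_trans (mnk k).2; near: k; exact: nbhs_infty_gt.
have NR : 0 < (n k)%:R :> R by rewrite ltr0n.
apply: (hK _ _ (3 * ((m k)%:R / (n k)%:R) - 2)) => //.
  by field; rewrite gt_eqF.
have a1 : (2 + nu0) / 3 < (m k)%:R / (n k)%:R.
  near: k; apply: (cvgr_gt c) => //; rewrite /nu0; lra.
have a2 : (m k)%:R / (n k)%:R < (2 + nu1) / 3.
  near: k; apply: (cvgr_lt c) => //; rewrite /nu1; lra.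
by apply/andP; split; lra.
Unshelve. all: by end_near. Qed.

Lemma ratio_lim_above (R : realType) (c : R) : 1 < c ->
  ratio_lim (@solvable_prob R) c 0.
Proof.
move=> c1 m n mnk mnc.
pose d : R := (c - 1) / (2 * c).
have d0 : 0 < d by rewrite /d divr_gt0; lra.
have d1 : d < 1 by rewrite /d ltr_pdivrMr; lra.
have dc : 1 + d < c.
  suff : d < c - 1 by lra.
  by rewrite /d ltr_pdivrMr; nra.
have up : d^-1 * k.+1%:R^-1 @[k --> \oo] --> (0 : R).
  by rewrite -(mulr0 d^-1); apply: cvgMr; exact: cvg_harmonic.
apply: (squeeze_cvgr _ (cvg_cst (0 : R)) up).
near=> k; rewrite solvable_prob_ge0 /=.
have k0 : (0 < k)%N by near: k; exact: nbhs_infty_gt.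
apply: le_trans (solvable_prob_le_pow R _ _) _.
have [mk nk] := mnk k.
have NR : 0 < (n k)%:R :> R by rewrite ltr0n (leq_trans k0).
have a1 : 1 + d < (m k)%:R / (n k)%:R.
  by near: k; apply: (cvgr_gt c).
rewrite ltr_pdivlMr // in a1.
have nm : (n k <= m k)%N by rewrite -(ler_nat R); nra.
rewrite -(subnKC nm) exprD invfM mulrA divff ?mul1r; last by rewrite expf_neq0.
set j := (m k - n k)%N.
have j0 : d * k%:R <= j%:R.
  have kn : k%:R <= (n k)%:R :> R by rewrite ler_nat.
  by rewrite /j natrB //; have := ler_wpM2l (ltW d0) kn; lra.
have dk : 0 < d * k.+1%:R := mulr_gt0 d0 (ltr0Sn _ _).
rewrite -invfM lef_pV2 ?posrE ?dk ?exprn_gt0 //.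
have j2 : j.+1%:R <= 2 ^+ j :> R by rewrite -natrX ler_nat ltn_expl.
by move: j2; rewrite -!natr1; lra.
Unshelve. all: by end_near. Qed.

Lemma sat_threshold1 (R : realType) : is_sat_threshold (1 : R).
Proof.
split; first lra.
move=> c; split; [exact: ratio_lim_below|exact: ratio_lim_above].
Qed.

(** Rounding c n with n = (k+1)^2 leaves room to add k, which ensures m >= k
    without changing the limit. *)
Lemma exists_ratio_sequence (R : realType) (c : R) : 0 < c ->
  exists m n : nat -> nat, (forall k, (k <= m k)%N /\ (k <= n k)%N) /\
    (m k)%:R / (n k)%:R @[k --> \oo] --> c.
Proof.
move=> c0.
pose n k := (k.+1 ^ 2)%N; pose m k := (Num.truncn (c * (n k)%:R) + k)%N.
exists m, n; split=> [k|].
  by split; [exact: leq_addl|rewrite /n; lia].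
have up : c + k.+1%:R^-1 @[k --> \oo] --> c.
  by rewrite -[X in _ --> X]addr0; apply: cvgD; [exact: cvg_cst|exact: cvg_harmonic].
have lo : c - k.+1%:R^-1 @[k --> \oo] --> c.
  by rewrite -[X in _ --> X]subr0; apply: cvgB; [exact: cvg_cst|exact: cvg_harmonic].
apply: (squeeze_cvgr _ lo up); near=> k.
have S0 : 0 < k.+1%:R :> R by rewrite ltr0n.
have nE : (n k)%:R = k.+1%:R ^+ 2 :> R by rewrite natrX.
have n0 : 0 < (n k)%:R :> R by rewrite nE exprn_gt0.
have cn0 : 0 <= c * (n k)%:R by rewrite mulr_ge0 // ltW.
have /andP[t1 t2] := truncn_itv cn0.
have nV : k.+1%:R^-1 * (n k)%:R = k.+1%:R :> R by rewrite nE; field; rewrite gt_eqF.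
rewrite ler_pdivlMr // ler_pdivrMr // mulrBl mulrDl nV /m natrD.
have k0 : 0 <= k%:R :> R by exact: ler0n.
have kE : k.+1%:R = k%:R + 1 :> R by rewrite natr1.
rewrite kE; move: t1 t2; rewrite -[(Num.truncn _).+1%:R]natr1.
by move: (c * _) => u t1 t2; apply/andP; split; lra.
Unshelve. all: by end_near. Qed.

Theorem corollary3p2 (R : realType) : unique (@is_sat_threshold R) 1%R.
Proof.
split; first exact: sat_threshold1.
move=> cs [cs0 hcs].
have no c : 2 / 3 < c -> ratio_lim (@solvable_prob R) c 0 ->
    ratio_lim (@solvable_prob R) c 1 -> False.
  move=> c0 l0 l1; have cp : 0 < c by lra.
  have [m [n [mn cv]]] := exists_ratio_sequence cp.
  have e : 0 = 1 :> R.
    exact: (cvg_unique (@norm_hausdorff _ R) (l0 m n mn cv) (l1 m n mn cv)).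
  by have := oner_neq0 R; rewrite -e eqxx.
have [h|h|//] := ltgtP 1 cs; exfalso.
- pose c := (1 + cs) / 2; apply: (no c); first by rewrite /c; lra.
    by apply: ratio_lim_above; rewrite /c; lra.
  by apply: (hcs c).1; rewrite /c; lra.
- pose c := (1 + cs) / 2; apply: (no c); first by rewrite /c; lra.
    by apply: (hcs c).2; rewrite /c; lra.
  by apply: ratio_lim_below; rewrite /c; lra.
Qed.
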